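(* As $n\to\infty$, $$\sum_{0\le k\le \lambda}\left|\mathbb{P}(X_n=k)-2^{-\lambda}\binom{\lambda}{k}+\left(\mathbb{E}(X_n)-\frac{\lambda}{2}\right)2^{-\lambda}\binom{\lambda}{k}\frac{\lambda+1-2k}{\lambda+1-k}\right|=\frac{16\,|F_2(\log_2 n)|}{\sqrt{2\pi e}\,\log_2 n}+O\left((\log n)^{-3/2}\right),$$ where $F_2$ is the function of period $1$ (that is, $F_2(x+1)=F_2(x)$) defined for $x\in[0,1)$ by $$F_2(x)=2^{-x}\sum_{j\ge1}2^{-d_j}\left(\frac{d_j(d_j+5)}{8}-\frac{j\,d_j}{2}+\frac{j(j-3)}{2}+1\right),$$ when writing $2^x=\sum_{j\ge1}2^{-d_j}\in[1,2)$ with integers $0=d_1<d_2<\cdots$ (the binary expansion of $2^x$, a finite sum if $2^x$ is a dyadic rational; the sum defining $F_2(x)$ runs over the same indices $j$).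
   Context: $X_n$ is the number of 1s in the binary representation of an integer chosen uniformly at random from $\{0,1,\ldots,n-1\}$, and $\lambda=\lfloor\log_2 n\rfloor$. *)

(* Defs.v *)
From HB Require Import structures.
From mathcomp Require Import all_boot all_order all_algebra.
From mathcomp Require Import all_classical all_reals all_analysis.
From mathcomp Require Import ring lra zify.

Set Implicit Arguments.
Unset Strict Implicit.
Unset Printing Implicit Defensive.

Import Order.TTheory GRing.Theory Num.Theory.
Import numFieldNormedType.Exports.

Local Open Scope classical_set_scope.
Local Open Scope ring_scope.

(* The binary representation of m > 0 has (trunc_log 2 m).+1 digits; since     *)
(* trunc_log 2 0 = 0, the integer 0 is written with the single digit 0.        *)
Definition ones (m : nat) : nat :=
  (\sum_(i < (trunc_log 2 m).+1) odd (m %/ 2 ^ i))%N.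

Definition unif_prob (R : realType) (T : finType) (A : {set T}) : R :=
  #|A|%:R / #|T|%:R.

Definition unif_mean (R : realType) (T : finType) (Y : T -> R) : R :=
  (\sum_(t : T) Y t) / #|T|%:R.

Definition X (n : nat) (m : 'I_n) : nat := ones m.

Definition log2 (R : realType) (x : R) : R := ln x / ln 2.

Definition lambda (R : realType) (n : nat) : nat :=
  Num.truncn (log2 n%:R : R).

(* The coefficient of 2 ^- d in the binary expansion of y in [1, 2). Digits    *)
(* obtained by truncation are eventually 0, not eventually 1, when y is dyadic *)
Definition bdigit (R : realType) (y : R) (d : nat) : bool :=
  odd (Num.truncn (y * 2 ^+ d)).

Definition nones (R : realType) (y : R) (d : nat) : nat :=
  (\sum_(i < d) bdigit y i)%N.

(* onepos y j is Some d_j where d_1 < d_2 < ... are the positions of the       *)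
(* digits 1 of y, or None when y has fewer than j digits 1.                    *)
Definition onepos (R : realType) (y : R) (j : nat) : option nat :=
  if pselect (exists d, bdigit y d && (nones y d.+1 == j)) is left dP
  then Some (ex_minn dP) else None.

(* The sum of g j d_j over those j in 1 .. N for which d_j is defined.         *)
Definition onepos_sum (R : realType) (y : R) (g : nat -> nat -> R) (N : nat)
    : R :=
  \sum_(1 <= j < N.+1) if onepos y j is Some d then g j d else 0.

Definition F2_01 (R : realType) (x : R) : R :=
  2 `^ (- x) *
  limn (onepos_sum (2 `^ x) (fun j d =>
    2 ^- d * (d%:R * (d%:R + 5) / 8 - j%:R * d%:R / 2
              + j%:R * (j%:R - 3) / 2 + 1))).

Definition F2 (R : realType) (x : R) : R := F2_01 (x - (Num.floor x)%:~R).

Lemma nonesS (R : realType) (y : R) d :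
  nones y d.+1 = (nones y d + bdigit y d)%N.
Proof. by rewrite /nones big_ord_recr. Qed.

Lemma oneposP (R : realType) (y : R) j d :
  onepos y j = Some d <-> bdigit y d /\ nones y d.+1 = j.
Proof.
have mono d1 d2 : bdigit y d2 -> (d1 < d2)%N ->
    (nones y d1.+1 < nones y d2.+1)%N.
  move=> b2 lt12; rewrite [X in (_ < X)%N]nonesS b2 addn1 ltnS /nones.
  rewrite -!(big_mkord xpredT (fun i => bdigit y i : nat)).
  by rewrite [leqRHS](big_cat_nat (n := d1.+1)) //= leq_addr.
rewrite /onepos; case: pselect => [e|ne]; last first.
  split=> // -[bd nd]; exfalso; apply: ne; exists d.
  by rewrite bd nd eqxx.
case: ex_minnP => d0 /andP[b0 /eqP n0] _; split=> [[<-]//|[b n]].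
congr Some; case: (ltngtP d0 d) => // lt.
- by have := mono _ _ b lt; rewrite n n0 ltnn.
- by have := mono _ _ b0 lt; rewrite n n0 ltnn.
Qed.

Lemma truncn_pow2 (R : realType) (y : R) d : 0 <= y ->
  Num.truncn (y * 2 ^+ d.+1) =
  ((Num.truncn (y * 2 ^+ d)).*2 + bdigit y d.+1)%N.
Proof.
move=> y0; rewrite /bdigit.
set m := Num.truncn _; set p := Num.truncn _.
have /andP[p1 p2] : p%:R <= y * 2 ^+ d < p.+1%:R.
  by apply: truncn_itv; rewrite mulr_ge0// exprn_ge0.
have /andP[m1 m2] : m%:R <= y * 2 ^+ d.+1 < m.+1%:R.
  by apply: truncn_itv; rewrite mulr_ge0// exprn_ge0.
have e2 : y * 2 ^+ d.+1 = 2 * (y * 2 ^+ d) by rewrite exprS; ring.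
have h1 : (p.*2 < m.+1)%N.
  rewrite -(ltr_nat R); apply: le_lt_trans m2.
  by rewrite e2 -muln2 natrM mulrC ler_pM2l.
have h2 : (m < p.+1.*2)%N.
  rewrite -(ltr_nat R); apply: le_lt_trans m1 _.
  by rewrite e2 -muln2 natrM [ltRHS]mulrC ltr_pM2l.
by have := odd_double_half m; lia.
Qed.

Lemma digit_sumE (R : realType) (y : R) D : 1 <= y < 2 ->
  \sum_(d < D.+1 | bdigit y d) 2 ^- d =
  (Num.truncn (y * 2 ^+ D))%:R / 2 ^+ D :> R.
Proof.
move=> /andP[y1 y2]; have y0 : 0 <= y by lra.
elim: D => [|D IH].
  have t1 : Num.truncn y = 1%N by apply: truncn_def; rewrite y1.
  by rewrite big_mkcond big_ord1 /bdigit expr0 mulr1 t1 /= divr1 invr1.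
rewrite big_mkcond big_ord_recr -big_mkcond /= IH truncn_pow2//.
have n2 : (2 : R) ^+ D != 0 by rewrite expf_neq0.
rewrite natrD -muln2 natrM exprS; case: bdigit => /=; field;
  by rewrite n2.
Qed.

Lemma onepos1 (R : realType) (y : R) : 1 <= y < 2 -> onepos y 1 = Some 0%N.
Proof.
move=> /andP[y1 y2]; apply/oneposP.
have b0 : bdigit y 0.
  by rewrite /bdigit expr0 mulr1 (_ : Num.truncn y = 1%N)//;
    apply: truncn_def; rewrite y1.
by rewrite /nones big_ord1 b0.
Qed.

Lemma onepos_lt (R : realType) (y : R) j d : (0 < j)%N ->
  onepos y j.+1 = Some d -> exists2 d', onepos y j = Some d' & (d' < d)%N.
Proof.
move=> j0 /oneposP[bd]; rewrite nonesS bd addn1 => -[].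
elim: d {bd} => [|d IH]; first by rewrite /nones big_ord0 => j1; rewrite -j1 in j0.
have [bd nd|/negbTE bd] := boolP (bdigit y d).
  by exists d => //; apply/oneposP.
by rewrite nonesS bd addn0 => /IH[d' ? ?]; exists d' => //; apply: ltnW.
Qed.

Lemma onepos_dyadic (R : realType) (a e : nat) j d :
  onepos (a%:R / 2 ^+ e : R) j = Some d -> (d <= e)%N.
Proof.
move=> /oneposP[+ _]; rewrite leqNgt; apply: contraL => ed.
rewrite /bdigit -(subnK ed) addnS -addSn exprD mulrCA divfK ?expf_neq0//.
by rewrite -natrX -natrM natrK oddM oddX.
Qed.

(* For y in [1, 2), the lemmas onepos1, onepos_lt, onepos_dyadic and           *)
(* onepos_sum_cvg say that 0 = d_1 < d_2 < ... , that there are finitely many  *)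
(* d_j when y is dyadic, and that y is the sum of the 2 ^- d_j.                *)
Lemma onepos_sum_cvg (R : realType) (y : R) : 1 <= y < 2 ->
  onepos_sum y (fun _ d => 2 ^- d) @ \oo --> y.
Proof.
move=> y12; set S := onepos_sum _ _.
have y0 : 0 <= y by case/andP: y12 => ? ?; lra.
have S_bnd : nondecreasing_seq S.
  apply/nondecreasing_seqP => n; rewrite /S /onepos_sum.
  rewrite [leRHS]big_nat_recr//= lerDl; case: onepos => // d.
have ST D : S (nones y D) = \sum_(d < D | bdigit y d) 2 ^- d.
  elim: D => [|D IH].
    by rewrite /S /onepos_sum /nones !big_ord0 big_geq.
  rewrite big_mkcond big_ord_recr -big_mkcond /= -IH nonesS.
  have [bD|_] := boolP (bdigit y D); last by rewrite addn0 addr0.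
  rewrite addn1 /S /onepos_sum big_nat_recr//=.
  have -> // : onepos y (nones y D).+1 = Some D.
  by apply/oneposP; rewrite nonesS bD addn1.
have SD N : exists D, S N = S (nones y D).
  elim: N => [|N [D IH]]; first by exists 0%N; rewrite /nones big_ord0.
  case E : (onepos y N.+1) => [d|].
    by exists d.+1; move/oneposP: E => [_ ->].
  by exists D; rewrite -IH /S /onepos_sum big_nat_recr//= E addr0.
have Tle D : S (nones y D) <= y /\ y < S (nones y D.+1) + 2 ^- D.
  have p2 d : (0 : R) < 2 ^+ d by rewrite exprn_gt0.
  have trP d := truncn_itv (mulr_ge0 y0 (ltW (p2 d))).
  split.
    case: D => [|D]; first by rewrite ST big_ord0.
    by rewrite ST digit_sumE// ler_pdivrMr//; case/andP: (trP D).
  rewrite ST digit_sumE// -{2}[2 ^- D]mul1r -mulrDl ltr_pdivlMr//.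
  by rewrite natr1; case/andP: (trP D).
have half_cvg : (fun D => 2 ^- D : R) @ \oo --> (0 : R).
  under eq_fun do rewrite -exprVn.
  by apply: cvg_expr; rewrite ger0_norm ?invr_ge0//; lra.
apply/cvgrPdist_lt => e e0.
have /cvgrPdist_lt /(_ e e0)[D _ /(_ D (leqnn D))] := half_cvg.
rewrite /= sub0r normrN ger0_norm ?invr_ge0 ?exprn_ge0// => De.
exists (nones y D.+1) => // N /= DN.
have [D' SN] := SD N.
have SNy : S N <= y by rewrite SN; case: (Tle D').
have := S_bnd _ _ DN; have [_] := Tle D.
by rewrite ger0_norm ?subr_ge0//; lra.
Qed.

Lemma F2_periodic (R : realType) (x : R) : F2 (x + 1) = F2 x.
Proof.
rewrite /F2; congr F2_01.
by rewrite floorDrz ?rpred1// floor1 intrD opprD addrACA subrr addr0.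
Qed.

Lemma F2E (R : realType) (x : R) : 0 <= x < 1 -> F2 x = F2_01 x.
Proof.
move=> x01; have e : Num.floor x = 0 by apply: floor_def; rewrite add0r.
by rewrite /F2 e subr0.
Qed.

(* Main.v *)
Require Import Defs.
From HB Require Import structures.
From mathcomp Require Import all_boot all_order all_algebra.
From mathcomp Require Import all_classical all_reals all_analysis.
From mathcomp Require Import ring lra zify.

Set Implicit Arguments.
Unset Strict Implicit.
Unset Printing Implicit Defensive.

Import Order.TTheory GRing.Theory Num.Theory.
Import numFieldNormedType.Exports.

Local Open Scope classical_set_scope.
Local Open Scope ring_scope.

(** Write l for lambda, y = n / 2^l in [1, 2), B = (X + 1)/2, H = (X - 1)/2.
    Probability distributions on the naturals are encoded by their generating
    polynomials, and the sum of absolute values in the theorem is, up to the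
    last two coefficients, the l1 norm of the coefficients of a polynomial.

    The integers below n split according to the first binary digit 1 of n that
    they turn into 0. If this digit has position d and is preceded by a digits
    1, the remaining l - d digits are free, so that
      sum_(m < n) X^(ones m) / n = y^-1 sum_d 2^-d X^a B^(l - d),
    the sum being over the positions d of the digits 1 of n, that is, of y
    ([ones_poly_mantissa]). Expanding in powers of X - 1 = 2 H,
      X^a B^(l - d) = B^l (1 + c1 (X - 1) + c2 (X - 1)^2) + H^3 B^(l - d) Q
    with c1 = a - d/2, with c2 = a(a - 1)/2 - a d/2 + d(d + 1)/8 and with
    coefficients of Q polynomial in d. Averaging over d with the weights
    2^-d / y turns c1 into E(X_n) - l/2 and c2 into F_2(log2 n). As
    (X - 1) B^l encodes minus the backward difference of the binomial
    distribution, the first two terms are what the theorem subtracts, and what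
    is left is F_2(log2 n) (X - 1)^2 B^l and a remainder.

    For the remainder, the norm of H B^m is at most (m + 1)^(-1/2): the
    coefficients are those of B^(m + 1) times (2 j - m - 1) / (m + 1), and a
    binomial variable has standard deviation sqrt(m + 1) in this scale
    ([pnorm_halfdiffX]). The norm is submultiplicative, so H^3 B^L has norm
    O(L^(-3/2)) ([pnorm_halfdiff3X]), and the factors 2^-d absorb the
    polynomial growth in d ([pnorm_remainder]).

    For the main term, let S_l be the norm of (X - 1)^2 B^l. The coefficients
    of this polynomial have the sign of (2 j - l - 2)^2 - (l + 2) and telescope
    between sign changes, so that S_l is four times a single first difference.
    When l + 1 = 4 t^2 the sign changes are explicit, and S_l is 4/t times the
    binomial probability of 2 t^2 - t successes in 4 t^2 trials
    ([second_diff_norm_fourth_square]). Wallis' product for the central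
    binomial coefficient, and elementary bounds for the ratio to it, give
    S_l = 16 / (sqrt(2 pi e) l) + O(l^(-3/2)) for these l. Since S_l is
    nonincreasing in l and such l are close enough to each other, the same
    holds for every l ([second_diff_norm_asymptotics]). *)

(** * The l1 norm of the coefficients of a polynomial *)

Definition pnorm (R : numDomainType) (p : {poly R}) : R :=
  \sum_(i < size p) `|p`_i|.

Lemma pnorm_wide (R : numDomainType) (p : {poly R}) N : (size p <= N)%N ->
  pnorm p = \sum_(i < N) `|p`_i|.
Proof.
move=> pN; rewrite /pnorm (big_ord_widen N (fun i => `|p`_i|))// big_mkcond /=.
by apply: eq_bigr => i _; case: ltnP => // /(nth_default 0) ->; rewrite normr0.
Qed.

Lemma pnorm_ge0 (R : numDomainType) (p : {poly R}) : 0 <= pnorm p.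
Proof. exact: sumr_ge0. Qed.

Lemma le_sum_pnorm (R : numDomainType) (p : {poly R}) N :
  \sum_(i < N) `|p`_i| <= pnorm p.
Proof.
rewrite (pnorm_wide (leq_maxr N (size p))).
rewrite (big_ord_widen _ (fun i => `|p`_i|) (leq_maxl N (size p))).
by rewrite big_mkcond /=; apply: ler_sum => i _; case: ifP.
Qed.

Lemma pnormD (R : numDomainType) (p q : {poly R}) :
  pnorm (p + q) <= pnorm p + pnorm q.
Proof.
set N := maxn (size p) (size q).
rewrite (pnorm_wide (size_polyD p q)).
rewrite (pnorm_wide (leq_maxl _ _ : (size p <= N)%N)).
rewrite (pnorm_wide (leq_maxr _ _ : (size q <= N)%N)) -big_split /=.
by apply: ler_sum => i _; rewrite coefD ler_normD.
Qed.

Lemma pnormZ (R : numDomainType) (c : R) (p : {poly R}) :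
  pnorm (c *: p) = `|c| * pnorm p.
Proof.
rewrite (pnorm_wide (size_scale_leq c p)) /pnorm mulr_sumr.
by apply: eq_bigr => i _; rewrite coefZ normrM.
Qed.

Lemma pnormN (R : numDomainType) (p : {poly R}) : pnorm (- p) = pnorm p.
Proof. by rewrite -scaleN1r pnormZ normrN1 mul1r. Qed.

Lemma pnorm0 (R : numDomainType) : pnorm (0 : {poly R}) = 0.
Proof. by rewrite /pnorm size_poly0 big_ord0. Qed.

Lemma pnormC (R : numDomainType) (c : R) : pnorm c%:P = `|c|.
Proof. by rewrite (pnorm_wide (size_polyC_leq1 c)) big_ord1 coefC. Qed.

Lemma pnormMX (R : numDomainType) (p : {poly R}) : pnorm (p * 'X) = pnorm p.
Proof.
rewrite (@pnorm_wide _ (p * 'X) (size p).+1); last first.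
  by rewrite (leq_trans (size_polyMleq _ _))// size_polyX addn2.
rewrite big_ord_recl coefMX normr0 add0r.
by apply: eq_bigr => i _; rewrite coefMX.
Qed.

Lemma pnorm_sum (R : numDomainType) I (s : seq I) (P : pred I)
    (F : I -> {poly R}) :
  pnorm (\sum_(i <- s | P i) F i) <= \sum_(i <- s | P i) pnorm (F i).
Proof.
elim/big_rec2: _ => [|i x p _ IH]; first by rewrite pnorm0.
by rewrite (le_trans (pnormD _ _))// lerD2l.
Qed.

Lemma pnormM (R : numDomainType) (p q : {poly R}) :
  pnorm (p * q) <= pnorm p * pnorm q.
Proof.
elim/poly_ind: p => [|p c IH]; first by rewrite mul0r pnorm0 mul0r.
have -> : pnorm (p * 'X + c%:P) = pnorm p + `|c|.
  rewrite (@pnorm_wide _ _ (size p).+1); last first.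
    by rewrite size_MXaddC; case: ifP.
  rewrite big_ord_recl coefD coefMX coefC add0r addrC; congr (_ + _).
  by apply: eq_bigr => i _; rewrite coefD coefMX coefC addr0.
rewrite mulrDl mulrDl (le_trans (pnormD _ _))// lerD//.
  by rewrite mulrAC pnormMX.
by rewrite mul_polyC pnormZ.
Qed.

Lemma pnormX_le1 (R : numDomainType) (p : {poly R}) n :
  pnorm p <= 1 -> pnorm (p ^+ n) <= 1.
Proof.
move=> p1; elim: n => [|n IH]; first by rewrite expr0 pnormC normr1.
by rewrite exprS (le_trans (pnormM _ _))// mulr_ile1// pnorm_ge0.
Qed.

Lemma pnormMl_le (R : numDomainType) (p q : {poly R}) :
  pnorm p <= 1 -> pnorm (p * q) <= pnorm q.
Proof.
by move=> p1; rewrite (le_trans (pnormM _ _))// ler_piMl// pnorm_ge0.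
Qed.

(** Stated for partial sums because the sum in the theorem stops before the
    last coefficients of the polynomials to which it is applied. *)
Lemma pnorm_triangle (R : numDomainType) (p q : {poly R}) N :
  `|\sum_(i < N) `|p`_i| - \sum_(i < N) `|q`_i| | <= pnorm (p - q).
Proof.
rewrite -sumrB (le_trans _ (le_sum_pnorm (p - q) N))//.
rewrite (le_trans (ler_norm_sum _ _ _))//; apply: ler_sum => i _.
by rewrite coefB ler_dist_dist.
Qed.

(** * Generating polynomials of binomial distributions *)

Definition halfsum (R : numFieldType) : {poly R} := 2^-1 *: ('X + 1).
Definition halfdiff (R : numFieldType) : {poly R} := 2^-1 *: ('X - 1).

Lemma halfsum_add_halfdiff (R : numFieldType) : halfsum R + halfdiff R = 'X.
Proof.
rewrite /halfsum /halfdiff -scalerDr addrACA subrr addr0 -mulr2n.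
by rewrite -(scaler_nat 2 'X) scalerA mulVf ?pnatr_eq0// scale1r.
Qed.

Lemma halfsumE (R : numFieldType) : halfsum R = 1 + halfdiff R.
Proof.
rewrite /halfsum /halfdiff -!mul_polyC.
have e2 : 2 * (2^-1)%:P = 1 :> {poly R}.
  by rewrite -(polyC_natr _ 2) -polyCM divff ?pnatr_eq0.
by rewrite -[X in _ = X + _]e2; ring.
Qed.

Lemma polyX_halfdiff (R : numFieldType) : 'X = 1 + 2 *: halfdiff R.
Proof. by rewrite /halfdiff scalerA divff ?pnatr_eq0// scale1r; ring. Qed.

Lemma pnorm_X (R : numDomainType) : pnorm ('X : {poly R}) = 1.
Proof. by rewrite -[X in pnorm X]mul1r pnormMX pnormC normr1. Qed.

Lemma pnorm_halfsum (R : numFieldType) : pnorm (halfsum R) <= 1.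
Proof.
rewrite pnormZ ger0_norm ?invr_ge0// -[leRHS](@mulVf _ 2) ?pnatr_eq0//.
rewrite ler_wpM2l ?invr_ge0// (le_trans (pnormD _ _))//.
by rewrite pnorm_X pnormC normr1.
Qed.

Lemma pnorm_halfdiff (R : numFieldType) : pnorm (halfdiff R) <= 1.
Proof.
rewrite pnormZ ger0_norm ?invr_ge0// -[leRHS](@mulVf _ 2) ?pnatr_eq0//.
rewrite ler_wpM2l ?invr_ge0// (le_trans (pnormD _ _))//.
by rewrite pnorm_X pnormN pnormC normr1.
Qed.

Lemma size_halfsumX (R : numFieldType) n : (size (halfsum R ^+ n) <= n.+1)%N.
Proof.
rewrite (leq_trans (size_poly_exp_leq _ _))// ltnS -[leqRHS]mul1n leq_mul2r.
rewrite orbC -subn1 leq_subLR addn1.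
by rewrite (leq_trans (size_scale_leq _ _))// size_XaddC.
Qed.

Lemma coef_halfsumX (R : numFieldType) n k :
  (halfsum R ^+ n)`_k = 2 ^- n * 'C(n, k)%:R.
Proof.
rewrite exprZn coefZ exprVn; congr (_ * _).
elim: n k => [|n IH] k.
  by rewrite expr0 coef1 bin0n; case: k.
rewrite exprS mulrDl mul1r coefD coefXM !IH.
case: k => [|k] /=; first by rewrite ?addr0 ?add0r !bin0.
by rewrite binS natrD addrC.
Qed.

Lemma halfsum1 (R : numFieldType) : (halfsum R).[1] = 1.
Proof. by rewrite !hornerE mulVf ?pnatr_eq0. Qed.

Lemma halfdiff1 (R : numFieldType) : (halfdiff R).[1] = 0.
Proof. by rewrite !hornerE subrr mulr0. Qed.

(** The operator 2 X d/dX - M multiplies the j-th coefficient by 2 j - M. It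
    recentres a binomial distribution on M trials at its mean, and it turns
    B^M into a multiple of H B^(M - 1): this is how the differences of the
    binomial distribution become the distribution itself times a polynomial in
    2 j - M. *)
Definition tilt (R : numFieldType) (M : nat) (p : {poly R}) : {poly R} :=
  2 *: ('X * p^`()) - M%:R *: p.

Lemma coef_tilt (R : numFieldType) M (p : {poly R}) j :
  (tilt M p)`_j = (2 * j%:R - M%:R) * p`_j.
Proof.
rewrite /tilt coefB !coefZ coefXM.
case: j => [|j] /=; first by ring.
by rewrite coef_deriv -mulr_natr; ring.
Qed.

Lemma deriv_halfsum (R : numFieldType) : (halfsum R)^`() = (2^-1)%:P.
Proof. by rewrite /halfsum derivZ derivD derivX derivC addr0 -alg_polyC. Qed.

Lemma deriv_halfdiff (R : numFieldType) : (halfdiff R)^`() = (2^-1)%:P.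
Proof. by rewrite /halfdiff derivZ derivB derivX derivC subr0 -alg_polyC. Qed.

Lemma tilt_halfsumX (R : numFieldType) M :
  tilt M.+1 (halfsum R ^+ M.+1) = M.+1%:R *: (halfdiff R * halfsum R ^+ M).
Proof.
rewrite /tilt deriv_exp deriv_halfsum /= -!mul_polyC !polyC_natr.
have e2 : 2 * (2^-1)%:P = 1 :> {poly R}.
  by rewrite -(polyC_natr _ 2) -polyCM divff ?pnatr_eq0.
rewrite -(mulr_natr (_ * _) M.+1).
transitivity (2 * (2^-1)%:P * 'X * (halfsum R ^+ M) * M.+1%:R
    - M.+1%:R * (halfsum R ^+ M.+1)); first by ring.
by rewrite e2 mul1r -halfsum_add_halfdiff exprS; ring.
Qed.

Lemma tilt_halfdiffX (R : numFieldType) M :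
  tilt M.+2 (halfdiff R * halfsum R ^+ M.+1)
  = halfsum R ^+ M.+2 + M.+1%:R *: (halfdiff R ^+ 2 * halfsum R ^+ M).
Proof.
rewrite /tilt derivM deriv_exp deriv_halfsum deriv_halfdiff /=.
rewrite -!mul_polyC !polyC_natr.
have e2 : 2 * (2^-1)%:P = 1 :> {poly R}.
  by rewrite -(polyC_natr _ 2) -polyCM divff ?pnatr_eq0.
rewrite -(mulr_natr (_ * _) M.+1) -halfsum_add_halfdiff.
set B := halfsum R; set H := halfdiff R.
transitivity ((2 * (2^-1)%:P) * (B + H) * (B ^+ M.+1 + H * B ^+ M * M.+1%:R)
  - M.+2%:R * (H * B ^+ M.+1)); first by ring.
by rewrite e2 mul1r !exprS -[in M.+2%:R]addn1 natrD; ring.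
Qed.

Lemma tilt2_halfsumX (R : numFieldType) M :
  tilt M.+2 (tilt M.+2 (halfsum R ^+ M.+2))
  = M.+2%:R *: (halfsum R ^+ M.+2
                + M.+1%:R *: (halfdiff R ^+ 2 * halfsum R ^+ M)).
Proof.
rewrite tilt_halfsumX -tilt_halfdiffX /tilt.
by rewrite derivZ -!mul_polyC; ring.
Qed.

(** The second difference of the binomial distribution is the distribution on
    two more trials times a quadratic polynomial, whence its sign. *)
Lemma coef_halfdiff2 (R : numFieldType) M j :
  M.+2%:R * M.+1%:R * (halfdiff R ^+ 2 * halfsum R ^+ M)`_j
  = ((2 * j%:R - M.+2%:R) ^+ 2 - M.+2%:R) * (halfsum R ^+ M.+2)`_j.
Proof.
have := congr1 (fun p : {poly R} => p`_j) (tilt2_halfsumX R M).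
rewrite /= !coef_tilt coefZ coefD coefZ => e.
by rewrite mulrBl expr2 -[_ * _ * (halfsum R ^+ M.+2)`_j]mulrA e; ring.
Qed.

Lemma sum_coef_horner1 (R : numDomainType) (p : {poly R}) N : (size p <= N)%N ->
  \sum_(i < N) p`_i = p.[1].
Proof.
move=> pN; rewrite (horner_coef_wide _ pN).
by apply: eq_bigr => i _; rewrite expr1n mulr1.
Qed.

(** The second moment of a centred simple random walk of M + 1 steps. It is
    read off by evaluating at 1 the polynomial tilted twice: the terms with a
    factor H vanish there. *)
Lemma sum_tilt2_coef (R : numFieldType) M :
  \sum_(j < M.+2) (2 * j%:R - M.+1%:R) ^+ 2 * (halfsum R ^+ M.+1)`_j = M.+1%:R.
Proof.
pose p := tilt M.+1 (tilt M.+1 (halfsum R ^+ M.+1)).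
transitivity (\sum_(j < M.+2) p`_j).
  by apply: eq_bigr => j _; rewrite /p !coef_tilt mulrA expr2.
have tilt_size n (q : {poly R}) : (size q <= M.+2)%N ->
    (size (tilt n q) <= M.+2)%N.
  move=> sq; apply/leq_sizeP => i /(leq_trans sq) qi.
  by rewrite coef_tilt (nth_default _ qi) mulr0.
rewrite sum_coef_horner1; last by rewrite !tilt_size// size_halfsumX.
rewrite /p tilt_halfsumX /tilt !(derivZ, derivM, deriv_halfdiff).
rewrite !(halfdiff1, halfsum1, hornerD, hornerN, hornerZ, hornerM, hornerX,
  hornerC, horner_exp).
by rewrite expr1n; field.
Qed.

(** * Differences of the binomial distribution up to order three *)

(** The norm of H B^m is the mean of |S| / N, where S is a simple random walk
    of N = m + 1 steps; since S^2 has mean N, this mean is at most N^(-1/2). *)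
Lemma pnorm_halfdiffX (R : rcfType) m :
  pnorm (halfdiff R * halfsum R ^+ m) <= (Num.sqrt m.+1%:R)^-1.
Proof.
set s := Num.sqrt _.
have s0 : 0 < s by rewrite sqrtr_gt0 ltr0n.
have s2 : s ^+ 2 = m.+1%:R by rewrite sqr_sqrtr// ler0n.
have N0 : (0 : R) < m.+1%:R by rewrite ltr0n.
have sz : (size (halfdiff R * halfsum R ^+ m)%R <= m.+2)%N.
  rewrite -(size_scale _ (lt0r_neq0 N0)) -tilt_halfsumX.
  apply/leq_sizeP => i mi; rewrite coef_tilt coef_halfsumX bin_small//.
  by rewrite !mulr0.
rewrite (pnorm_wide sz) -(ler_pM2l N0) mulr_sumr.
pose b (j : nat) : R := (halfsum R ^+ m.+1)`_j.
have b0 j : 0 <= b j by rewrite /b coef_halfsumX mulr_ge0// invr_ge0 exprn_ge0.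
have b1 : \sum_(j < m.+2) b j = 1.
  by rewrite sum_coef_horner1 ?size_halfsumX// horner_exp halfsum1 expr1n.
(* Average the inequality |x| <= (x^2 / s + s) / 2, optimal for |x| = s. *)
apply: (@le_trans _ _ (\sum_(j < m.+2)
    ((2 * j%:R - m.+1%:R) ^+ 2 * b j / s + s * b j) / 2)).
  apply: ler_sum => j _; rewrite -[in leLHS](ger0_norm (ltW N0)) -normrM.
  rewrite -coefZ -tilt_halfsumX coef_tilt -/(b j) normrM (ger0_norm (b0 j)).
  set x := 2 * _ - _.
  rewrite mulrAC -mulrDl mulrAC; apply: ler_wpM2r => //.
  rewrite ler_pdivlMr// -[x ^+ 2]real_normK ?num_real//.
  rewrite -subr_ge0; set y := `|x|.
  suff -> : y ^+ 2 / s + s - y * 2 = (y - s) ^+ 2 / s.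
    by rewrite divr_ge0 ?sqr_ge0// ltW.
  by field; rewrite lt0r_neq0.
rewrite -mulr_suml big_split /= -mulr_suml -mulr_sumr b1 sum_tilt2_coef.
by rewrite -s2 mulr1 le_eqVlt; apply/orP; left; apply/eqP; field;
  rewrite lt0r_neq0.
Qed.

(** One factor H B^(L/3) for each of the three factors H. *)
Lemma pnorm_halfdiff3X (R : rcfType) L :
  pnorm (halfdiff R ^+ 3 * halfsum R ^+ L) <= 8 * (Num.sqrt L.+1%:R) ^- 3.
Proof.
(* The other L mod 3 factors B are dropped; 2 sqrt (m + 1) >= sqrt (L + 1). *)
pose m := (L %/ 3)%N.
have -> : halfdiff R ^+ 3 * halfsum R ^+ L
    = halfsum R ^+ (L %% 3) * (halfdiff R * halfsum R ^+ m) ^+ 3.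
  rewrite {1}(divn_eq L 3) exprMn -exprM exprD -/m; ring.
rewrite (le_trans (pnormMl_le _ (pnormX_le1 _ (pnorm_halfsum R))))//.
set p := _ * _.
have p3 : pnorm (p ^+ 3) <= pnorm p ^+ 3.
  rewrite !exprS expr0 !mulr1 (le_trans (pnormM _ _))//.
  by rewrite ler_wpM2l ?pnorm_ge0// pnormM.
rewrite (le_trans p3)//.
have -> : (8 : R) = 2 ^+ 3 by ring.
rewrite -exprVn -exprMn.
rewrite lerXn2r ?nnegrE ?pnorm_ge0 ?mulr_ge0 ?invr_ge0 ?sqrtr_ge0//.
rewrite (le_trans (pnorm_halfdiffX R m))//.
rewrite ler_pdivlMr ?sqrtr_gt0 ?ltr0n// mulrC ler_pdivrMr ?sqrtr_gt0 ?ltr0n//.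
have -> : (2 : R) = Num.sqrt 4
  by rewrite -[2]ger0_norm// -sqrtr_sqr; congr Num.sqrt; ring.
rewrite -sqrtrM//.
rewrite ler_wsqrtr// -natrM ler_nat.
by have := divn_eq L 3; have := ltn_pmod L (isT : 0 < 3)%N; rewrite -/m; lia.
Qed.

(** * Second-order expansion with cubic remainder *)

Lemma bin_le_expn n k : ('C(n, k) <= n ^ k)%N.
Proof.
rewrite -(leq_pmul2r (fact_gt0 k)) bin_ffact.
apply: (@leq_trans (n ^ k)); last by rewrite leq_pmulr ?fact_gt0.
elim: k => [|k IH]; first by rewrite ffactn0.
by rewrite ffactnSr expnSr leq_mul// leq_subr.
Qed.

(** For s = 1 and s = 2 the base 1 + s H is B and X, of norm at most 1, so that
    the cubic remainder grows like that of the scalar binomial expansion. *)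
Lemma taylor3 (R : numFieldType) (s : R) n : 0 <= s ->
  pnorm (1 + s *: halfdiff R) <= 1 ->
  exists2 q : {poly R}, (1 + s *: halfdiff R) ^+ n
    = 1 + (n%:R * s) *: halfdiff R + ('C(n, 2)%:R * s ^+ 2) *: halfdiff R ^+ 2
      + halfdiff R ^+ 3 * q
   & pnorm q <= s ^+ 3 * 'C(n, 3)%:R.
Proof.
move=> s0 s1; elim: n => [|n [q qE qn]].
  exists 0; last by rewrite pnorm0 bin0n mulr0.
  by rewrite expr0 bin0n !mul0r !scale0r mulr0 !addr0.
exists ((1 + s *: halfdiff R) * q + ('C(n, 2)%:R * s ^+ 3)%:P).
  rewrite exprS qE binS bin1 natrD -natr1 -!mul_polyC !(polyCD, polyCM,
    polyC_exp).
  rewrite !polyC_natr; ring.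
rewrite (le_trans (pnormD _ _))// pnormC ger0_norm ?mulr_ge0 ?exprn_ge0//.
by rewrite binS natrD mulrDr lerD ?(le_trans (pnormMl_le _ s1) qn)// mulrC.
Qed.

(** The coefficients of X - 1 and (X - 1)^2 in X^a B^(-d): the difference of
    mean, and the analogue for the second factorial moment, between the
    generating polynomials X^a B^(l - d) and B^l. *)
Definition shift1 (R : numFieldType) (a d : nat) : R := a%:R - d%:R / 2.

Definition shift2 (R : numFieldType) (a d : nat) : R :=
  a%:R * (a%:R - 1) / 2 - a%:R * d%:R / 2 + d%:R * (d%:R + 1) / 8.

Lemma norm_shift1 (R : realFieldType) a d : (a <= d)%N ->
  `|2 * shift1 R a d| <= d.+1%:R.
Proof.
rewrite -(ler_nat R) => ad; have a0 : (0 : R) <= a%:R by [].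
by rewrite ler_norml /shift1 -natr1; apply/andP; split; lra.
Qed.

Lemma norm_shift2 (R : realFieldType) a d : (a <= d)%N ->
  `|4 * shift2 R a d| <= 5 * d.+1%:R ^+ 2.
Proof.
rewrite -(ler_nat R) => ad; have a0 : (0 : R) <= a%:R by [].
by rewrite ler_norml /shift2 -natr1; apply/andP; split; nra.
Qed.

(** The constants [shift1] and [shift2] are those for which the expansions of
    X^a and of B^d in powers of H agree up to order 2. The exponent 5 is only
    a convenient power dominating the remainders of these expansions. *)
Lemma second_order_expansion (R : realFieldType) a d : (a <= d)%N ->
  exists2 Q : {poly R},
    'X ^+ a - halfsum R ^+ d * (1 + (2 * shift1 R a d) *: halfdiff R
                                  + (4 * shift2 R a d) *: halfdiff R ^+ 2)
      = halfdiff R ^+ 3 * Q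
    & pnorm Q <= 26 * d.+1%:R ^+ 5.
Proof.
move=> ad; set c1 := 2 * _; set c2 := 4 * _; set H := halfdiff R.
have [|| q1] := @taylor3 R 2 a; first by [].
  by rewrite -polyX_halfdiff pnorm_X.
rewrite -polyX_halfdiff -/H => q1E q1n.
have [|| q2] := @taylor3 R 1 d; first by [].
  by rewrite scale1r -halfsumE pnorm_halfsum.
rewrite scale1r -halfsumE -/H !expr1n !mulr1 mul1r => q2E q2n.
pose e : R := 'C(d, 2)%:R.
exists (q1 - ((c1 * e + c2 * d%:R) *: 1 + (c2 * e) *: H
              + (1 + c1 *: H + c2 *: H ^+ 2) * q2)).
  have bin2R (n : nat) : 'C(n, 2)%:R = n%:R * (n%:R - 1) / 2 :> R.
    case: n => [|n]; first by rewrite bin0n !mul0r.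
    apply/(@mulIf _ 2); rewrite ?pnatr_eq0// divfK ?pnatr_eq0//.
    by rewrite -natrM mulnC -mul_bin_diag bin1 natrM -natr1 addrK.
  have E1 : a%:R * 2 = c1 + d%:R by rewrite /c1 /shift1; field.
  have E2 : 'C(a, 2)%:R * 2 ^+ 2 = e + c1 * d%:R + c2 :> R.
    by rewrite /e !bin2R /c1 /c2 /shift1 /shift2; field.
  rewrite q1E q2E -/e E1 E2 -!mul_polyC !(polyCD, polyCM).
  by ring.
have D1 : (1 : R) <= d.+1%:R by rewrite ler1n.
have bound k (n : nat) : (n <= d)%N -> 'C(n, k)%:R <= d.+1%:R ^+ k :> R.
  move=> nd; apply: (@le_trans _ _ (n ^ k)%:R);
    first by rewrite ler_nat bin_le_expn.
  by rewrite natrX lerXn2r ?nnegrE// ler_nat leqW.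
have e2 : e <= d.+1%:R ^+ 2 by exact: bound.
have e0 : 0 <= e by [].
have d1 : d%:R <= d.+1%:R :> R by rewrite ler_nat.
have {}q1n : pnorm q1 <= 8 * d.+1%:R ^+ 3.
  rewrite (le_trans q1n)// (_ : 2 ^+ 3 = 8 :> R); last by ring.
  by rewrite ler_wpM2l// bound.
have {}q2n : pnorm q2 <= d.+1%:R ^+ 3 by rewrite (le_trans q2n)// bound.
have c1n : `|c1| <= d.+1%:R by exact: norm_shift1.
have c2n : `|c2| <= 5 * d.+1%:R ^+ 2 by exact: norm_shift2.
have H1 : pnorm H <= 1 by exact: pnorm_halfdiff.
have H2 : pnorm (H ^+ 2) <= 1 by exact: pnormX_le1.
have one1 : pnorm (1 : {poly R}) = 1 by rewrite pnormC normr1.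
clear q1E q2E; clearbody c1 c2.
move: (d.+1%:R) D1 e2 d1 q1n q2n c1n c2n => D D1 e2 d1 q1n q2n c1n c2n.
have D0 : 0 <= D by lra.
have f1 : pnorm ((c1 * e + c2 * d%:R) *: (1 : {poly R})) <= 6 * D ^+ 3.
  rewrite pnormZ one1 mulr1 (le_trans (ler_normD _ _))// !normrM.
  rewrite (ger0_norm e0) (@ger0_norm _ d%:R)//.
  have -> : 6 * D ^+ 3 = D * D ^+ 2 + (5 * D ^+ 2) * D by ring.
  by apply: lerD; apply: ler_pM.
have f2 : pnorm ((c2 * e) *: H) <= 5 * D ^+ 4.
  rewrite pnormZ normrM (ger0_norm e0).
  have -> : 5 * D ^+ 4 = (5 * D ^+ 2 * D ^+ 2) * 1 by ring.
  by rewrite ler_pM ?mulr_ge0 ?pnorm_ge0 ?ler_pM.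
have f3 : pnorm (1 + c1 *: H + c2 *: H ^+ 2) <= 1 + D + 5 * D ^+ 2.
  rewrite (le_trans (pnormD _ _))// lerD//.
    rewrite (le_trans (pnormD _ _))// one1 lerD2l pnormZ -[leRHS]mulr1.
    by rewrite ler_pM ?pnorm_ge0.
  by rewrite pnormZ -[leRHS]mulr1 ler_pM ?pnorm_ge0.
have f4 : pnorm ((1 + c1 *: H + c2 *: H ^+ 2) * q2)
    <= (1 + D + 5 * D ^+ 2) * D ^+ 3.
  by rewrite (le_trans (pnormM _ _))// ler_pM ?pnorm_ge0.
apply: le_trans (pnormD _ _) _; rewrite pnormN.
apply: (@le_trans _ _ (8 * D ^+ 3 + (6 * D ^+ 3 + 5 * D ^+ 4
    + (1 + D + 5 * D ^+ 2) * D ^+ 3))).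
  rewrite lerD// (le_trans (pnormD _ _))// lerD//.
  by rewrite (le_trans (pnormD _ _))// lerD.
have D35 : D ^+ 3 <= D ^+ 5 by rewrite ler_weXn2l.
have D45 : D ^+ 4 <= D ^+ 5 by rewrite ler_weXn2l.
lra.
Qed.

(** Only l - d factors B are available against H^3, which costs a factor
    polynomial in d since l + 1 <= (d + 1) (l - d + 1). *)
Lemma pnorm_second_order (R : rcfType) a d l : (a <= d <= l)%N ->
  pnorm ('X ^+ a * halfsum R ^+ (l - d)
         - (1 + shift1 R a d *: ('X - 1) + shift2 R a d *: ('X - 1) ^+ 2)
           * halfsum R ^+ l)
  <= 208 * d.+1%:R ^+ 8 * (Num.sqrt l.+1%:R) ^- 3.
Proof.
move=> /andP[ad dl].
have [Q QE Qn] := second_order_expansion R ad.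
have -> : 'X ^+ a * halfsum R ^+ (l - d)
    - (1 + shift1 R a d *: ('X - 1) + shift2 R a d *: ('X - 1) ^+ 2)
      * halfsum R ^+ l
    = (halfdiff R ^+ 3 * halfsum R ^+ (l - d)) * Q.
  rewrite [RHS]mulrAC -QE.
  have -> : halfsum R ^+ l = halfsum R ^+ (l - d) * halfsum R ^+ d.
    by rewrite -exprD subnK.
  have -> : 'X - 1 = 2 *: halfdiff R by rewrite polyX_halfdiff; ring.
  move: (halfdiff R) (halfsum R) (shift1 R a d) (shift2 R a d) => H B c1 c2.
  rewrite exprZn !scalerA -!mul_polyC !polyCM ?polyC_exp.
  rewrite !(polyC_natr _ 2) !(polyC_natr _ 4).
  by ring.
rewrite (le_trans (pnormM _ _))//.
set s := Num.sqrt l.+1%:R; set u := Num.sqrt ((l - d)%N.+1%:R : R).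
have u0 : 0 < u by rewrite sqrtr_gt0 ltr0n.
have s0 : 0 < s by rewrite sqrtr_gt0 ltr0n.
have su : s <= d.+1%:R * u.
  rewrite -[d.+1%:R]ger0_norm// -sqrtr_sqr -sqrtrM ?sqr_ge0// ler_wsqrtr//.
  rewrite -natrX -natrM ler_nat.
  have : (l.+1 <= d.+1 * (l - d).+1)%N by nia.
  by nia.
have us : u ^- 3 <= d.+1%:R ^+ 3 * s ^- 3.
  rewrite ler_pdivlMr ?exprn_gt0// mulrC ler_pdivrMr ?exprn_gt0//.
  by rewrite -exprMn lerXn2r// nnegrE ?mulr_ge0// ltW.
apply: (@le_trans _ _ ((8 * (d.+1%:R ^+ 3 * s ^- 3)) * (26 * d.+1%:R ^+ 5))).
  apply: ler_pM; rewrite ?pnorm_ge0//.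
  by rewrite (le_trans (pnorm_halfdiff3X R _))// ler_wpM2l.
by rewrite le_eqVlt; apply/orP; left; apply/eqP; ring.
Qed.

(** * The norm of the second difference *)

Definition second_diff_norm (R : numFieldType) (l : nat) : R :=
  pnorm (('X - 1) ^+ 2 * halfsum R ^+ l).

Lemma size_second_diff (R : numFieldType) l :
  (size (('X - 1) ^+ 2 * halfsum R ^+ l)%R <= l.+3)%N.
Proof.
rewrite (leq_trans (size_polyMleq _ _))//.
have : (size (('X - 1 : {poly R}) ^+ 2) <= 3)%N.
  by rewrite (leq_trans (size_poly_exp_leq _ _))// -[1]/(1%:P) size_XsubC.
move: (size_halfsumX R l); move: (size (halfsum R ^+ l)).
by move: (size (('X - 1 : {poly R}) ^+ 2)%R) => u v; lia.
Qed.

Lemma second_diff_norm_noninc (R : numFieldType) l m : (l <= m)%N ->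
  second_diff_norm R m <= second_diff_norm R l.
Proof.
move=> lm; rewrite /second_diff_norm -(subnK lm) exprD mulrCA.
by rewrite pnormMl_le// pnormX_le1// pnorm_halfsum.
Qed.

Lemma sum_coef_mulXsub1 (R : nzRingType) (q : {poly R}) n :
  \sum_(j < n.+1) (('X - 1) * q)`_j = - q`_n.
Proof.
elim: n => [|n IH].
  by rewrite big_ord1 mulrBl mul1r coefB coefXM sub0r.
by rewrite big_ord_recr /= IH mulrBl mul1r coefB coefXM /= addKr.
Qed.

Lemma sum_ord_symm (V : nmodType) (f : nat -> V) K :
  (forall j, (j < K.*2)%N -> f (K.*2.-1 - j)%N = f j) ->
  \sum_(j < K.*2) f j = (\sum_(j < K) f j) *+ 2.
Proof.
move=> fs; rewrite mulr2n -addnn big_split_ord /=; congr (_ + _).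
rewrite (reindex_inj rev_ord_inj) /=; apply: eq_bigr => j _.
rewrite -[RHS]fs; last by have := ltn_ord j; lia.
by congr f; have := ltn_ord j; lia.
Qed.

(** The j-th coefficient has the sign of (2 j - M)^2 - M where M = 4 t^2 + 1;
    as 2 t < sqrt M < 2 t + 1, it is nonnegative for j up to J = 2 t^2 - t, and
    then nonpositive up to the centre. By symmetry the norm is twice the sum
    over the left half, and this half sums to 0, so it is four times the sum
    up to J, which telescopes. *)
Lemma second_diff_norm_fourth_square (R : realFieldType) t l : (0 < t)%N ->
  l.+1 = (4 * t ^ 2)%N ->
  second_diff_norm R l = 4 / t%:R * (2 ^- l.+1 * 'C(l.+1, 2 * t ^ 2 - t)%:R).
Proof.
move=> t0 lE; have tt : (t <= 2 * t ^ 2)%N by nia.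
have XH : 'X - 1 = 2 *: halfdiff R by rewrite polyX_halfdiff; ring.
have tsq : (2 * t ^ 2)%:R = 2 * t%:R ^+ 2 :> R by rewrite natrM natrX.
pose K := (2 * t ^ 2).+1; have KE : K.*2 = l.+3 by rewrite /K; lia.
pose x j := (('X - 1) ^+ 2 * halfsum R ^+ l)`_j.
pose w j : R := 4 / (l.+2%:R * l.+1%:R) * (halfsum R ^+ l.+2)`_j.
have w0 j : 0 <= w j.
  rewrite /w coef_halfsumX.
  by rewrite !mulr_ge0 ?divr_ge0 ?mulr_ge0 ?invr_ge0 ?exprn_ge0.
have xE j : x j = w j * ((2 * j%:R - l.+2%:R) ^+ 2 - l.+2%:R).
  rewrite /x /w XH exprZn -scalerAl coefZ.
  have ab : (l.+2%:R * l.+1%:R : R) != 0 by rewrite mulf_neq0 ?pnatr_eq0.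
  apply: (mulfI ab); rewrite [LHS]mulrCA coef_halfdiff2.
  move: ab; move: (l.+2%:R) (l.+1%:R) => a b ab; field.
  by rewrite andbC -negb_or -mulf_eq0.
have partial n : \sum_(j < n.+1) x j
    = 2 / l.+1%:R * (l.+1%:R - 2 * n%:R) * (halfsum R ^+ l.+1)`_n.
  rewrite /x expr2 -mulrA sum_coef_mulXsub1 XH -scalerAl coefZ.
  have := congr1 (fun p : {poly R} => p`_n) (tilt_halfsumX R l).
  rewrite /= coef_tilt coefZ => e.
  have -> : l.+1%:R - 2 * n%:R = - (2 * n%:R - l.+1%:R) :> R by ring.
  rewrite mulrN mulNr -(mulrA (2 / _)) e; field.
  by rewrite ?natr1 ?nat1r pnatr_eq0.
(* At the centre the first difference vanishes. *)
have sumK : \sum_(j < K) x j = 0.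
  rewrite partial lE; set u := _ - _; suff -> : u = 0 by rewrite mulr0 mul0r.
  by rewrite /u !natrM; ring.
rewrite /second_diff_norm (pnorm_wide (size_second_diff R l)).
have symm j : (j < K.*2)%N -> `|x (K.*2.-1 - j)%N| = `|x j|.
  rewrite KE => jl; rewrite !xE /w !coef_halfsumX bin_sub//;
    congr `|_ * (_ - _)|.
  by rewrite -sqrrN natrB//; congr (_ ^+ 2); rewrite /=; ring.
rewrite -KE (@sum_ord_symm _ (fun j => `|x j|))//.
have -> : \sum_(j < K) `|x j| = \sum_(j < K) (`|x j| + x j).
  by rewrite big_split /= sumK addr0.
pose J := (2 * t ^ 2 - t)%N.
transitivity ((\sum_(j < J.+1) (x j *+ 2)) *+ 2).
  congr (_ *+ _); have JK : (J.+1 <= K)%N by rewrite /J /K; lia.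
  rewrite (big_ord_widen _ (fun j => x j *+ 2) JK) [RHS]big_mkcond.
  apply: eq_bigr => j _.
  have lR : l.+2%:R = 4 * t%:R ^+ 2 + 1 :> R
    by rewrite -addn1 lE natrD natrM natrX.
  have t1 : 1 <= t%:R :> R by rewrite ler1n.
  case: ltnP => jJ.
    rewrite ger0_norm ?mulr2n// xE mulr_ge0// lR.
    have : (j + t <= 2 * t ^ 2)%N by move: jJ; rewrite /J; lia.
    by rewrite -(ler_nat R) natrD natrM natrX; nra.
  rewrite ler0_norm ?addNr// xE mulr_ge0_le0// lR.
  have : (2 * t ^ 2 + 1 <= j + t)%N by move: jJ; rewrite /J; lia.
  have : (j <= 2 * t ^ 2)%N by rewrite -ltnS; exact: ltn_ord.
  rewrite -!(ler_nat R) !(natrD _ (2 * t ^ 2)%N) (natrD _ j) tsq => j1 j2.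
  have u1 : 1 <= 4 * t%:R ^+ 2 + 1 - 2 * j%:R :> R by lra.
  have u2 : 4 * t%:R ^+ 2 + 1 - 2 * j%:R <= 2 * t%:R - 1 :> R by lra.
  by nra.
rewrite sumrMnl partial coef_halfsumX lE natrB// tsq (natrM _ 4) natrX.
rewrite -/J; move: (_ ^- _ * _) => v; rewrite -mulr_natr -(mulr_natr (_ * v)).
by field; rewrite pnatr_eq0; lia.
Qed.

(** * Wallis' product *)

(** The primitive of cos^n that vanishes at 0, given by the usual reduction
    formula; it makes the integrals of Wallis available without integration. *)
Fixpoint cos_primitive (R : realType) (n : nat) (x : R) : R :=
  match n with
  | 0 => x
  | 1 => sin x
  | n'.+2 => (sin x * cos x ^+ n'.+1 + n'.+1%:R * cos_primitive n' x) / n'.+2%:R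
  end.

Lemma cos_primitiveS2 (R : realType) (n : nat) (x : R) :
  cos_primitive n.+2 x
  = (sin x * cos x ^+ n.+1 + n.+1%:R * cos_primitive n x) / n.+2%:R.
Proof. by []. Qed.

Lemma is_derive_cos_primitive (R : realType) n (x : R) :
  is_derive x 1 (cos_primitive n) (cos x ^+ n).
Proof.
suff : is_derive x 1 (cos_primitive n) (cos x ^+ n) /\
       is_derive x 1 (cos_primitive n.+1) (cos x ^+ n.+1) by case.
elim: n => [|n [IH0 IH1]].
  by rewrite expr0 expr1; split; [exact: is_derive_id|exact: is_derive_sin].
split=> //.
have dX := is_deriveX n.+1 (is_derive_cos x).
have dM := is_deriveM (is_derive_sin x) dX.
have dD := is_deriveZ n.+2%:R^-1 (is_deriveD dM (is_deriveZ n.+1%:R IH0)).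
have <- : (n.+2%:R^-1 : R) \*: (sin * cos ^+ n.+1 + (n.+1%:R : R) \*:
  cos_primitive n)
    = cos_primitive n.+2.
  by apply/funext => y; rewrite cos_primitiveS2 [RHS]mulrC !fctE.
apply: is_derive_eq dD _; rewrite [n.+1.-1]/= fctE.
rewrite /GRing.scale [LHS]/= !exprS -[n.+2%:R]natr1.
have n2 : n.+1%:R + 1 != 0 :> R by rewrite natr1 pnatr_eq0.
have s2 := sin2cos2 x; rewrite expr2 in s2.
move: (n.+1%:R : R) (cos x ^+ n) n2 => a c a2.
have -> : sin x * (a * c * - sin x) = - (sin x * sin x) * (a * c) by ring.
rewrite s2; field.
exact: a2.
Qed.

Definition wallis (R : realType) n : R := cos_primitive n (pi / 2).

Lemma wallisS2 (R : realType) n :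
  wallis R n.+2 = n.+1%:R / n.+2%:R * wallis R n.
Proof.
by rewrite /wallis cos_primitiveS2 cos_pihalf expr0n mulr0 add0r mulrAC.
Qed.

(** The primitive of cos^n - cos^(n + 1) is nondecreasing on [0, pi/2]. *)
Lemma wallis_noninc (R : realType) n : wallis R n.+1 <= wallis R n.
Proof.
pose f : R -> R := cos_primitive n \- cos_primitive n.+1.
have df (x : R) : is_derive x 1 f (cos x ^+ n - cos x ^+ n.+1).
  by apply: is_deriveB; exact: is_derive_cos_primitive.
have p0 : 0 <= pi / 2 :> R by rewrite divr_ge0 ?pi_ge0.
have f0 m : cos_primitive m (0 : R) = 0.
  suff : cos_primitive m (0 : R) = 0 /\ cos_primitive m.+1 (0 : R) = 0 by case.
  elim: m => [|m [IH0 IH1]]; first by rewrite /= sin0.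
  by split=> //; rewrite cos_primitiveS2 IH0 sin0 mul0r mulr0 addr0 mul0r.
rewrite -subr_ge0.
have -> : 0 = f 0.
  rewrite -[RHS]/(cos_primitive n 0 - cos_primitive n.+1 0).
  by rewrite !f0 subrr.
apply: (@ger0_derive1_ndecr _ f 0 (pi / 2)) => //.
- move=> x; rewrite in_itv /= => /andP[x0 x1].
  rewrite derive1E derive_val exprS -[X in X - _]mul1r -mulrBl.
  rewrite mulr_ge0 ?subr_ge0 ?cos_le1//.
  rewrite exprn_ge0// cos_ge0_pihalf// (ltW x1) andbT.
  by rewrite (le_trans _ (ltW x0))// oppr_le0.
- apply: continuous_subspaceT => x; apply: differentiable_continuous.
  by apply/derivable1_diffP.
Qed.

Lemma wallis_mul (R : realType) n :
  n.+1%:R * wallis R n * wallis R n.+1 = pi / 2.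
Proof.
elim: n => [|n IH].
  by rewrite /wallis /= sin_pihalf mulr1 mul1r.
rewrite -IH wallisS2; have : n.+2%:R != 0 :> R by rewrite pnatr_eq0.
by move: (n.+2%:R : R) => r r0; field.
Qed.

Lemma wallis_even (R : realType) m :
  wallis R m.*2 = pi / 2 * (2 ^- m.*2 * 'C(m.*2, m)%:R).
Proof.
elim: m => [|m IH]; first by rewrite /wallis /= bin0 !mulr1 invr1 mulr1.
rewrite doubleS wallisS2 IH.
have H : ('C(m.*2.+2, m.+1) * m.+1 = 'C(m.*2, m) * m.*2.+1 * 2)%N.
  have := mul_bin_diag m.*2.+1 m; rewrite /= (binS m.*2.+1 m).
  have <- : 'C(m.*2.+1, m.*2.+1 - m.+1) = 'C(m.*2.+1, m.+1)
    by rewrite bin_sub//; lia.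
  by rewrite (_ : m.*2.+1 - m.+1 = m)%N; nia.
have {}H : 'C(m.*2.+2, m.+1)%:R
  = 'C(m.*2, m)%:R * m.*2.+1%:R * 2 / m.+1%:R :> R.
  by apply/(canRL (mulfK _)); rewrite ?pnatr_eq0// -!natrM H.
have -> : m.*2.+2%:R = 2 * m.+1%:R :> R by rewrite -doubleS -muln2 natrM mulrC.
rewrite H !exprS.
have m1 : m.+1%:R != 0 :> R by rewrite pnatr_eq0.
have p2 : 2 ^+ m.*2 != 0 :> R by rewrite expf_neq0// pnatr_eq0.
move: (m.+1%:R : R) (2 ^+ m.*2 : R) ('C(m.*2, m)%:R : R) m1 p2 => a b c a0 b0.
by field; rewrite a0 b0.
Qed.

(** * Asymptotics of the norm of the second difference *)

(** Wallis' product: the integral W of cos^(2 m) is pi/2 times the central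
    binomial probability, and its products with its two neighbours, which
    enclose it, are known. *)
Lemma central_binomial_bounds (R : realType) m : (0 < m)%N ->
  2 / ((pi : R) * m.*2.+1%:R) <= (2 ^- m.*2 * 'C(m.*2, m)%:R) ^+ 2
    <= ((pi : R) * m%:R)^-1.
Proof.
move=> m0; set c := 2 ^- _ * _; have p0 := pi_gt0 R.
have c0 : 0 < c.
  rewrite /c mulr_gt0 ?invr_gt0 ?exprn_gt0//.
  by rewrite ltr0n bin_gt0 -addnn leq_addr.
have E : wallis R m.*2 = pi / 2 * c by rewrite wallis_even.
have W0 : 0 < wallis R m.*2 by rewrite E mulr_gt0// divr_gt0.
have mR : 0 < m%:R :> R by rewrite ltr0n.
apply/andP; split.
- have h := ler_wpM2l (ltW W0) (wallis_noninc R m.*2).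
  have {h} := ler_wpM2l (ler0n R m.*2.+1) h.
  rewrite mulrA wallis_mul E => h.
  rewrite ler_pdivrMr ?mulr_gt0//.
  rewrite -(@ler_pM2l _ (pi / 4)) ?divr_gt0//.
  by apply: le_trans (le_trans h _); rewrite le_eqVlt; apply/orP; left;
    apply/eqP; field.
- have h := wallis_noninc R m.*2.-1; rewrite prednK ?double_gt0// in h.
  have h1 := wallis_mul R m.*2.-1; rewrite prednK ?double_gt0// -mulrA in h1.
  have : m.*2%:R * (wallis R m.*2 * wallis R m.*2) <= pi / 2.
    by rewrite -h1 ler_wpM2l ?ler0n// ler_wpM2r// ltW.
  rewrite E -muln2 natrM => h2.
  rewrite -[leRHS]mul1r ler_pdivlMr ?mulr_gt0//.
  rewrite -(@ler_pM2l _ (pi / 2)) ?divr_gt0//.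
  by rewrite mulr1; apply: le_trans h2; rewrite le_eqVlt; apply/orP; left;
    apply/eqP; field.
Qed.

(** Successive ratios are (m - i)/(m + i + 1) = 1 - (2 i + 1)/(m + i + 1), and
    2 i + 1 sums to t^2. The bound T >= t on the number of steps makes the
    denominators independent of i. *)
Lemma offcentral_binomial_bounds (R : realType) m T t :
  (t <= T)%N -> (T <= m)%N ->
  let c : R := 2 ^- m.*2 * 'C(m.*2, m)%:R in
  c * expR (- (t%:R ^+ 2 / (m%:R - T%:R + 1)))
    <= 2 ^- m.*2 * 'C(m.*2, m - t)%:R
    <= c * expR (- (t%:R ^+ 2 / (m%:R + T%:R))).
Proof.
move=> tT Tm /=; rewrite -[X in X <= _]mulrA -[X in _ && (_ <= X)]mulrA.
rewrite !ler_pM2l ?invr_gt0 ?exprn_gt0//.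
have TR : T%:R <= m%:R :> R by rewrite ler_nat.
elim: t tT => [|t IH] tT.
  by rewrite subn0 expr0n /= !mul0r oppr0 expR0 mulr1 lexx.
have /andP[lo hi] := IH (ltnW tT).
have tR : t%:R + 1 <= T%:R :> R by rewrite natr1 ler_nat.
have t0 : 0 <= t%:R :> R by [].
have E : 'C(m.*2, m - t.+1)%:R * (m%:R + t%:R + 1)
  = 'C(m.*2, m - t)%:R * (m%:R - t%:R) :> R.
  have := mul_bin_left m.*2 (m - t.+1).
  rewrite (_ : (m - t.+1).+1 = m - t)%N; last by lia.
  rewrite (_ : m.*2 - (m - t.+1) = m + t + 1)%N; last by lia.
  move=> /(congr1 (fun n => n%:R : R)); rewrite !natrM !natrD natrB;
    last by lia.
  by move=> e; rewrite mulrC -e mulrC.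
have Em : 'C(m.*2, m - t.+1)%:R
  = 'C(m.*2, m - t)%:R * ((m%:R - t%:R) / (m%:R + t%:R + 1)) :> R.
  by rewrite mulrA -E mulfK// lt0r_neq0//; lra.
rewrite Em -natr1; move: lo hi Em => lo hi _.
set u := (_ - _) / (_ + _ + _).
have u0 : 0 < u by rewrite /u divr_gt0//; lra.
have hu : u <= expR (- ((2 * t%:R + 1) / (m%:R + T%:R))).
  apply: (@le_trans _ _ (1 + (- ((2 * t%:R + 1) / (m%:R + t%:R + 1))))).
    rewrite le_eqVlt; apply/orP; left; apply/eqP; rewrite /u; field.
    by apply: lt0r_neq0; lra.
  apply: le_trans (expR_ge1Dx _) _; rewrite ler_expR lerN2.
  by rewrite ler_wpM2l ?lef_pV2 ?posrE; lra.
have lu : expR (- ((2 * t%:R + 1) / (m%:R - T%:R + 1))) <= u.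
  rewrite expRN -[u]invrK lef_pV2 ?posrE ?invr_gt0 ?expR_gt0//.
  apply: (@le_trans _ _ (1 + (2 * t%:R + 1) / (m%:R - t%:R))).
    rewrite le_eqVlt; apply/orP; left; apply/eqP; rewrite /u; field.
    by apply/andP; split; apply: lt0r_neq0; lra.
  apply: le_trans (expR_ge1Dx _) _; rewrite ler_expR.
  by rewrite ler_wpM2l ?lef_pV2 ?posrE; lra.
clearbody u.
have sq : (t%:R + 1) ^+ 2 = t%:R ^+ 2 + (2 * t%:R + 1) :> R by ring.
rewrite sq !(mulrDl (t%:R ^+ 2) (2 * t%:R + 1)) !opprD !expRD.
rewrite [X in X <= _]mulrA [X in _ && (_ <= X)]mulrA.
by apply/andP; split; apply: ler_pM => //; rewrite ?mulr_ge0 ?expR_ge0// ltW.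
Qed.

(** With m = 2 t^2 and T = t the two exponents of the previous bounds are
    1/2 + O(1/t), and t times the central probability is
    (2 pi)^(-1/2) (1 + O(1/t)). *)
Lemma second_diff_norm_square_bounds (R : realType) t l : (0 < t)%N ->
  l.+1 = (4 * t ^ 2)%N ->
  let G : R := expR (- 2^-1) / Num.sqrt (2 * pi) in
  4 * G * (1 - t%:R^-1) ^+ 2 / t%:R ^+ 2 <= second_diff_norm R l
    <= 4 * G * (1 + t%:R^-1) / t%:R ^+ 2.
Proof.
move=> t0 lE /=; rewrite (second_diff_norm_fourth_square R t0 lE).
set s := Num.sqrt _.
have p0 := pi_gt0 R.
have s0 : 0 < s by rewrite sqrtr_gt0 mulr_gt0.
have s2 : s ^+ 2 = 2 * pi by rewrite sqr_sqrtr// mulr_ge0// ltW.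
pose m := (2 * t ^ 2)%N.
have m0 : (0 < m)%N by rewrite /m; nia.
have tm : (t <= m)%N by rewrite /m; nia.
have mE : m.*2 = l.+1 by rewrite lE /m; lia.
have /andP[clo chi] := central_binomial_bounds R m0.
have := offcentral_binomial_bounds R (leqnn t) tm.
rewrite /= -mE; move: clo chi; set c := _ * 'C(_, m)%:R;
  set b := _ * 'C(_, _)%:R.
have c0 : 0 <= c by rewrite /c mulr_ge0 ?invr_ge0 ?exprn_ge0.
have mR : m%:R = 2 * t%:R ^+ 2 :> R by rewrite natrM natrX.
have -> : m.*2.+1%:R = 4 * t%:R ^+ 2 + 1 :> R.
  by rewrite -natr1 -muln2 natrM mR; ring.
rewrite mR; clearbody b c s; move: (pi : R) p0 s2 => p p0 s2.
have a1 : 1 <= t%:R :> R by rewrite ler1n.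
move: (t%:R : R) a1 => a a1.
have a0 : 0 < a by lra.
have ai0 : 0 < a^-1 by rewrite invr_gt0.
have ai1 : a^-1 <= 1 by rewrite invf_le1.
have aai : a * a^-1 = 1 by rewrite divff ?lt0r_neq0.
move=> clo chi /andP[blo bhi].
have hexp : expR (- (a ^+ 2 / (2 * a ^+ 2 + a))) <= expR (- 2^-1) * (1 + a^-1).
  have -> : - (a ^+ 2 / (2 * a ^+ 2 + a)) = - 2^-1 + (2 * (2 * a + 1))^-1.
    by field; apply/andP; split; apply: lt0r_neq0; nra.
  rewrite expRD ler_pM2l ?expR_gt0//.
  set x := _^-1.
  have x4 : x <= (4 * a)^-1 by rewrite lef_pV2 ?posrE; lra.
  have x0 : 0 < x by rewrite invr_gt0; lra.
  have E : (4 * a)^-1 = a^-1 / 4 by field; rewrite lt0r_neq0.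
  rewrite E in x4.
  have x1 : 0 < 1 - x by lra.
  have h1 := expR_ge1Dx (- x).
  have h2 : expR x * expR (- x) = 1 by rewrite -expRD subrr expR0.
  have h3 : (1 - x) * expR x <= 1.
    rewrite -h2 mulrC ler_pM2l ?expR_gt0//; lra.
  rewrite -(ler_pM2l x1); apply: le_trans h3 _; nra.
have lexp : expR (- 2^-1) * (1 - a^-1)
  <= expR (- (a ^+ 2 / (2 * a ^+ 2 - a + 1))).
  have q0 : 0 < 2 * a ^+ 2 - a + 1 by nra.
  have -> : - (a ^+ 2 / (2 * a ^+ 2 - a + 1))
    = - 2^-1 - (a - 1) / (2 * (2 * a ^+ 2 - a + 1)).
    by field; apply: lt0r_neq0.
  rewrite expRD ler_pM2l ?expR_gt0//.
  apply: le_trans (expR_ge1Dx _); rewrite lerD2l lerN2.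
  rewrite ler_pdivrMr; [|lra]. nra.
have si2 : s^-1 ^+ 2 = (2 * p)^-1 by rewrite exprVn s2.
have hac : a * c <= s^-1.
  rewrite -(@ler_pXn2r _ 2)// ?nnegrE; last 2 first.
  - by rewrite mulr_ge0// ltW.
  - by rewrite invr_ge0 ltW.
  rewrite si2 exprMn; apply: le_trans (ler_wpM2l (exprn_ge0 2 (ltW a0)) chi) _.
  rewrite le_eqVlt; apply/orP; left; apply/eqP; field.
  by rewrite (lt0r_neq0 p0) (lt0r_neq0 a0).
have lac : s^-1 * (1 - a^-1) <= a * c.
  rewrite -(@ler_pXn2r _ 2)// ?nnegrE; last 2 first.
  - by rewrite mulr_ge0 ?invr_ge0 ?subr_ge0// ltW.
  - by rewrite mulr_ge0// ltW.
  rewrite exprMn si2 exprMn.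
  apply: le_trans (ler_wpM2l (exprn_ge0 2 (ltW a0)) clo).
  have q0 : 0 < 4 * a ^+ 2 + 1 by nra.
  rewrite -subr_ge0.
  have -> : a ^+ 2 * (2 / (p * (4 * a ^+ 2 + 1))) - (2 * p)^-1 * (1 - a^-1) ^+ 2
    = (2 * p)^-1 * (4 * a ^+ 2 / (4 * a ^+ 2 + 1) - (1 - a^-1) ^+ 2).
    by field; rewrite (lt0r_neq0 p0) (lt0r_neq0 a0) (lt0r_neq0 q0).
  rewrite mulr_ge0 ?invr_ge0 ?mulr_ge0 ?(ltW p0)// subr_ge0 ler_pdivlMr//.
  move: (a^-1) ai0 ai1 aai => i i0 i1 ai.
  have -> : (1 - i) ^+ 2 * (4 * a ^+ 2 + 1)
    = 4 * a ^+ 2 - 8 * a * (a * i) + 4 * (a * i) ^+ 2 + (1 - i) ^+ 2 by ring.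
  rewrite ai; nra.
set e := expR (- 2^-1) in hexp lexp *.
have e0 : 0 < e by exact: expR_gt0.
have b0 : 0 <= b by rewrite (le_trans _ blo)// mulr_ge0// expR_ge0.
have E : 4 / a * b = 4 * (a * b) / a ^+ 2 by field; rewrite lt0r_neq0.
rewrite E !ler_pM2r ?invr_gt0 ?exprn_gt0// -!mulrA !ler_pM2l//.
have ge0 : 0 <= 1 - a^-1 by rewrite subr_ge0.
apply/andP; split.
- apply: (@le_trans _ _ ((a * c) * (e * (1 - a^-1)))).
    have -> : e * (s^-1 * (1 - a^-1) ^+ 2)
      = (s^-1 * (1 - a^-1)) * (e * (1 - a^-1)) by ring.
    by apply: ler_wpM2r lac; rewrite mulr_ge0// ltW.
  rewrite -mulrA ler_pM2l//; apply: le_trans blo; exact: ler_wpM2l.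
- apply: (@le_trans _ _ ((a * c) * (e * (1 + a^-1)))).
    rewrite -mulrA ler_pM2l//; apply: le_trans bhi _; exact: ler_wpM2l.
  rewrite (mulrCA e); apply: ler_wpM2r hac.
  by rewrite mulr_ge0 ?addr_ge0// ltW.
Qed.

(** If 4 t^2 <= l + 1 < 4 (t + 1)^2, monotonicity encloses the norm between its
    values at the two ends, where 1/l varies by O(t^-3) only. The real number
    x stands for log2 n. *)
Lemma second_diff_norm_asymptotics (R : realType) : exists2 C : R, 0 <= C &
  forall l (x : R), (3 <= l)%N -> l%:R <= x <= l.+1%:R ->
  `| second_diff_norm R l - 16 / (Num.sqrt (2 * pi * expR 1) * x) |
    <= C * (Num.sqrt l.+1%:R) ^- 3.
Proof.
(* 84 / t^3 bounds the deviation, and sqrt (l + 1) <= 4 t. *)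
exists (84 * 64); first exact: mulr_ge0 (ler0n _ _) (ler0n _ _).
move=> l x l3 /andP[lx xl].
have [t t0 /andP[tl lt]] : exists2 t, (0 < t)%N
  & (4 * t ^ 2 <= l.+1 < 4 * t.+1 ^ 2)%N.
  elim: l l3 {lx xl} => // l IH; rewrite leq_eqVlt => /orP[/eqP <-|/IH].
    by exists 1%N.
  move=> [t t0 /andP[t1 t2]].
  have [lt|ge] := ltnP l.+2 (4 * t.+1 ^ 2); first by exists t => //; lia.
  by exists t.+1 => //; rewrite ge /=; nia.
have t4 : (0 < 4 * t ^ 2)%N by nia.
have [|_ hi] := andP (@second_diff_norm_square_bounds R t (4 * t ^ 2).-1 t0 _).
  by rewrite prednK.
have [|lo _] := andP (@second_diff_norm_square_bounds R t.+1 (4 * t.+1 ^ 2).-1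
  isT _).
  by rewrite prednK; nia.
have {}hi := le_trans (@second_diff_norm_noninc R (4 * t ^ 2).-1 l ltac:(lia))
  hi.
have {}lo := le_trans lo (@second_diff_norm_noninc R l (4 * t.+1 ^ 2).-1
  ltac:(lia)).
move: hi lo; set G := expR _ / _.
have p0 := pi_gt0 R.
have s0 : 0 < Num.sqrt (2 * pi) :> R by rewrite sqrtr_gt0 mulr_gt0.
have G0 : 0 < G by rewrite divr_gt0 ?expR_gt0.
have G1 : G <= 1.
  rewrite ler_pdivrMr// mul1r; apply: (@le_trans _ _ 1).
    by rewrite -[leRHS]expR0 ler_expR oppr_le0 invr_ge0.
  rewrite -[leLHS]sqrtr1 ler_wsqrtr//; have := pi_ge2 R; lra.
have sqE : Num.sqrt (2 * pi * expR 1) = Num.sqrt (2 * pi) * expR 2^-1 :> R.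
  have h : 0 <= 2 * pi :> R by rewrite mulr_ge0// ltW.
  rewrite (sqrtrM _ h); congr (_ * _).
  have -> : expR 1 = expR 2^-1 ^+ 2 :> R.
    by rewrite expr2 -expRD; congr expR; field.
  by rewrite sqrtr_sqr ger0_norm// expR_ge0.
have x0 : 0 < x.
  by apply: lt_le_trans lx; rewrite ltr0n; lia.
have -> : 16 / (Num.sqrt (2 * pi * expR 1) * x) = 16 * G / x.
  rewrite sqE /G expRN; move: (expR_gt0 (2^-1 : R)) s0.
  move: (expR _) (Num.sqrt _) => e s e0 s0; field.
  by rewrite (lt0r_neq0 e0) (lt0r_neq0 s0) (lt0r_neq0 x0).
have la : l.+1%:R <= 4 * (t%:R + 1) ^+ 2 :> R.
  by rewrite natr1 -natrX -natrM ler_nat; lia.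
have al : 4 * t%:R ^+ 2 <= l%:R + 1 :> R.
  by rewrite natr1 -natrX -natrM ler_nat.
have sa : (Num.sqrt l.+1%:R) ^+ 3 <= 64 * t%:R ^+ 3 :> R.
  have -> : 64 * t%:R ^+ 3 = (4 * t%:R) ^+ 3 :> R by ring.
  rewrite lerXn2r ?nnegrE ?mulr_ge0 ?sqrtr_ge0//.
  rewrite -[leRHS]ger0_norm ?mulr_ge0// -sqrtr_sqr ler_wsqrtr//.
  by rewrite -natrM -natrX ler_nat; nia.
have S0 : 0 < (Num.sqrt l.+1%:R : R) ^+ 3
  by rewrite exprn_gt0// sqrtr_gt0 ltr0n.
rewrite -[t.+1%:R]natr1 => hi lo.
have a1 : 1 <= t%:R :> R by rewrite ler1n.
move: (t%:R : R) a1 hi lo la al sa => a a1 hi lo la al sa.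
have a0 : 0 < a by lra.
apply: (@le_trans _ _ (84 * (G / a ^+ 3))); last first.
  rewrite -mulrA; apply: ler_wpM2l; first exact: ler0n.
  rewrite ler_pdivrMr ?exprn_gt0// mulrAC ler_pdivlMr//.
  apply: le_trans sa; rewrite -[leRHS]mul1r; apply: ler_wpM2r => //; exact: ltW.
have x1 : 4 * a ^+ 2 - 1 <= x by lra.
have x2 : x <= 4 * (a + 1) ^+ 2 by lra.
have a2 : 1 <= a ^+ 2 by nra.
have d0 : 0 < 4 * a ^+ 2 - 1 by lra.
have i1 : (4 * (a + 1) ^+ 2)^-1 <= x^-1.
  by rewrite lef_pV2// posrE mulr_gt0// exprn_gt0//; lra.
have i2 : x^-1 <= (4 * a ^+ 2 - 1)^-1 by rewrite lef_pV2.
have aa : a + 1 != 0 by apply: lt0r_neq0; lra.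
have an : a != 0 by apply: lt0r_neq0.
have dn : 4 * a ^+ 2 - 1 != 0 by apply: lt0r_neq0.
have a13 : 1 <= a ^+ 3 by rewrite exprn_ege1.
have up : (1 + a^-1) / a ^+ 2 - 4 * (4 * (a + 1) ^+ 2)^-1 <= 21 / a ^+ 3.
  rewrite -subr_ge0.
  have -> : 21 / a ^+ 3 - ((1 + a^-1) / a ^+ 2 - 4 * (4 * (a + 1) ^+ 2)^-1)
    = (18 * a ^+ 2 + 39 * a + 20) / (a ^+ 3 * (a + 1) ^+ 2).
    by field; rewrite aa an.
  have h1 : 0 <= a + 1 by lra.
  have h2 : 0 <= 18 * a ^+ 2 + 39 * a + 20 by nra.
  by rewrite divr_ge0// ?mulr_ge0 ?exprn_ge0// ltW.
have dw : 4 * (4 * a ^+ 2 - 1)^-1 - (1 - (a + 1)^-1) ^+ 2 / (a + 1) ^+ 2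
  <= 21 / a ^+ 3.
  rewrite -subr_ge0.
  have -> : 21 / a ^+ 3 - (4 * (4 * a ^+ 2 - 1)^-1 - (1 - (a + 1)^-1) ^+ 2 /
    (a + 1) ^+ 2)
    = (68 * a ^+ 6 + 311 * a ^+ 5 + 467 * a ^+ 4
       + (248 * a ^+ 3 - 42 * a ^+ 2 - 84 * a - 21))
      / (a ^+ 3 * (a + 1) ^+ 4 * (4 * a ^+ 2 - 1)).
    by field; rewrite aa an dn.
  have a23 : a ^+ 2 <= a ^+ 3 by rewrite ler_weXn2l.
  have a12 : a <= a ^+ 2 by rewrite expr2 ler_peMl// ltW.
  have num : 0 <= 248 * a ^+ 3 - 42 * a ^+ 2 - 84 * a - 21 by lra.
  have a1_0 : 0 <= a + 1 by rewrite addr_ge0// ltW.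
  have den : 0 <= a ^+ 3 * (a + 1) ^+ 4 * (4 * a ^+ 2 - 1).
    by apply: mulr_ge0; rewrite ?mulr_ge0 ?exprn_ge0// ltW.
  have pos (c k : nat) : 0 <= c%:R * a ^+ k.
    by apply: mulr_ge0; [exact: ler0n|apply: exprn_ge0; exact: ltW].
  exact: (divr_ge0 (addr_ge0 (addr_ge0 (addr_ge0 (pos 68 6) (pos 311 5))
    (pos 467 4)) num) den).
have G4 : 0 <= 4 * G by rewrite mulr_ge0// ltW.
rewrite ler_norml; apply/andP; split.
- have := ler_wpM2l G4 dw; have := ler_wpM2l G4 i2; lra.
- have := ler_wpM2l G4 up; have := ler_wpM2l G4 i1; lra.
Qed.

(** * Digit sums of the integers below n *)

Lemma sum_wide_ones m N : (m < 2 ^ N)%N ->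
  ones m = (\sum_(i < N) odd (m %/ 2 ^ i))%N.
Proof.
move=> mN; rewrite /ones.
have [->|m0] := posnP m.
  by rewrite !big1// => i _; rewrite div0n.
have tN : ((trunc_log 2 m).+1 <= N)%N.
  by rewrite -(ltn_exp2l _ _ (isT : 1 < 2)%N) (leq_ltn_trans _ mN)// trunc_logP.
rewrite (big_ord_widen N (fun i => odd (m %/ 2 ^ i) : nat) tN) big_mkcond.
apply: eq_bigr => i _; case: ltnP => // ti.
rewrite divn_small// (leq_trans (trunc_log_ltn m (isT : 1 < 2)%N))//.
by rewrite leq_exp2l.
Qed.

Lemma ones0 : ones 0 = 0%N.
Proof. by rewrite (@sum_wide_ones 0 0) ?big_ord0. Qed.

Lemma ones_double_add q (b : bool) : ones (q.*2 + b) = (ones q + b)%N.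
Proof.
have qN : (q < 2 ^ q)%N by rewrite ltn_expl.
rewrite (sum_wide_ones qN) (@sum_wide_ones _ q.+1); last first.
  by rewrite expnS; case: b => /=; lia.
rewrite big_ord_recl expn0 divn1 oddD odd_double addFb oddb addnC;
  congr (_ + _)%N.
apply: eq_bigr => i _; rewrite /= /bump /= add1n expnS divnMA.
by rewrite -muln2 divnMDl// (divn_small (_ : b < 2)%N) ?addn0//; case: b.
Qed.

Definition ones_poly (R : nzSemiRingType) (n : nat) : {poly R} :=
  \sum_(m < n) 'X^(ones m).

(** Appending a digit b to q: each integer below q has two continuations, and
    q itself has the continuation 0 when b = 1. *)
Lemma ones_poly_double (R : comNzRingType) q (b : bool) :
  ones_poly R (q.*2 + b) = ('X + 1) * ones_poly R q + b%:R * 'X^(ones q).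
Proof.
have even : ones_poly R q.*2 = ('X + 1) * ones_poly R q.
  elim: q => [|q IH]; first by rewrite /ones_poly !big_ord0 mulr0.
  rewrite /ones_poly doubleS !big_ord_recr /= mulrDr -/(ones_poly R _) IH.
  have := ones_double_add q false; rewrite addn0 => ->.
  have := ones_double_add q true; rewrite addn1 => ->.
  by rewrite addn1 addn0 exprS /ones_poly; ring.
case: b; last by rewrite addn0 even mul0r addr0.
by rewrite addn1 /ones_poly big_ord_recr /= -/(ones_poly R _) even mul1r
  -[q.*2]addn0 (ones_double_add q false) addn0.
Qed.

Section Digits.
Variables (R : realType) (y : R).
Hypothesis y12 : 1 <= y < 2.
Let y0 : 0 <= y. Proof. by case/andP: y12 => *; lra. Qed.

Definition leading (d : nat) : nat := Num.truncn (y * 2 ^+ d).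

Lemma leadingS d : leading d.+1 = ((leading d).*2 + bdigit y d.+1)%N.
Proof. exact: truncn_pow2. Qed.

Lemma leading0 : leading 0 = 1%N.
Proof. by rewrite /leading expr0 mulr1; apply: truncn_def. Qed.

Lemma bdigit0 : bdigit y 0.
Proof. by rewrite /bdigit -/(leading 0) leading0. Qed.

Lemma ones_leading d : ones (leading d) = nones y d.+1.
Proof.
elim: d => [|d IH].
  by rewrite leading0 nonesS bdigit0 /nones big_ord0 (ones_double_add 0 true)
    ones0.
by rewrite leadingS ones_double_add IH [RHS]nonesS.
Qed.

(** Here d is the position of the first digit in which an integer below the
    prefix differs from it: a digit 1 of y, replaced by 0. *)
Lemma ones_poly_leading D : ones_poly R (leading D) =
  \sum_(d < D.+1 | bdigit y d) 'X^(nones y d) * ('X + 1) ^+ (D - d).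
Proof.
elim: D => [|D IH].
  rewrite leading0 /ones_poly big_ord1 ones0 big_mkcond big_ord1 bdigit0.
  by rewrite /nones big_ord0 mulr1.
rewrite leadingS ones_poly_double IH mulr_sumr [RHS]big_mkcond big_ord_recr /=.
rewrite -big_mkcond /= ones_leading subnn expr0 mulr1.
congr (_ + _); last by case: bdigit; rewrite ?mul1r ?mul0r.
apply: eq_bigr => d _; rewrite subSn ?exprS; last by have := ltn_ord d.
by rewrite mulrCA.
Qed.

Lemma nones_le d : (nones y d <= d)%N.
Proof.
rewrite -[leqRHS]card_ord -sum1_card; apply: leq_sum => i _.
exact: leq_b1.
Qed.

Lemma onepos_sum_nones (g : nat -> nat -> R) D :
  onepos_sum y g (nones y D) = \sum_(d < D | bdigit y d) g (nones y d.+1) d.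
Proof.
elim: D => [|D IH].
  by rewrite /onepos_sum /nones !big_ord0 big_geq.
rewrite big_mkcond big_ord_recr -big_mkcond /= -IH nonesS.
have [bD|_] := boolP (bdigit y D); last by rewrite addn0 addr0.
rewrite addn1 /onepos_sum big_nat_recr//=.
have -> // : onepos y (nones y D).+1 = Some D.
by apply/oneposP; rewrite nonesS bD addn1.
Qed.

Lemma nones_homo d e : (d <= e)%N -> (nones y d <= nones y e)%N.
Proof.
move=> /subnK <-; elim: (e - d)%N => // k IH.
by rewrite addSn nonesS (leq_trans IH)// leq_addr.
Qed.

(** For dyadic y the digits after position e vanish, and the partial sums are
    eventually constant. *)
Lemma lim_onepos_sum (g : nat -> nat -> R) a e : y = a%:R / 2 ^+ e ->
  limn (onepos_sum y g) = \sum_(d < e.+1 | bdigit y d) g (nones y d.+1) d.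
Proof.
move=> ye; rewrite -onepos_sum_nones; apply: lim_near_cst => //.
exists (nones y e.+1) => // N /= eN; rewrite -(subnK eN).
elim: (N - _)%N => [|k IH]; first by rewrite add0n.
rewrite addSn /onepos_sum big_nat_recr//= -/(onepos_sum y g _) IH.
case E : (onepos _ _) => [d|]; last by rewrite addr0.
have de : (d <= e)%N by move: E; rewrite ye => /onepos_dyadic.
by have := nones_homo (de : d < e.+1)%N; move/oneposP: E => [_ ->]; lia.
Qed.

End Digits.

Lemma unif_prob_onesE (R : realType) n k :
  unif_prob R [set m : 'I_n | X m == k] = (ones_poly R n)`_k / n%:R.
Proof.
rewrite /unif_prob card_ord; congr (_ / _).
rewrite /ones_poly coef_sum -sum1_card natr_sum big_mkcond /=.
by apply: eq_bigr => m _; rewrite coefXn finset.inE /X eq_sym; case: eqP.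
Qed.

Lemma unif_mean_onesE (R : realType) n :
  unif_mean (fun m : 'I_n => (X m)%:R : R) = (ones_poly R n)^`().[1] / n%:R.
Proof.
rewrite /unif_mean card_ord /ones_poly raddf_sum horner_sum; congr (_ / _).
by apply: eq_bigr => m _; rewrite /= derivXn hornerMn hornerXn expr1n.
Qed.

(** * Geometric sums of powers *)

(** From x <= exp x applied to (d + 1)/q, with q so large that the p-th power
    of exp (1/q) is at most exp (1/4) <= 4/3, the terms are dominated by those
    of a geometric series of ratio 2/3. *)
Lemma geometric_moment_bounded (R : realType) p :
  exists2 K : R, 0 <= K & forall D, \sum_(d < D) 2 ^- d * d.+1%:R ^+ p <= K.
Proof.
pose q : R := (4 * p.+1)%:R.
have q0 : 0 < q by rewrite ltr0n.
exists (4 * (q ^+ p * (4 / 3))).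
  by rewrite !mulr_ge0// exprn_ge0// ltW.
have e14 : expR 4^-1 <= 4 / 3 :> R.
  have h1 := expR_ge1Dx (- 4^-1 : R).
  have h2 : expR 4^-1 * expR (- 4^-1) = 1 :> R by rewrite -expRD subrr expR0.
  have h3 : 3 / 4 <= expR (- 4^-1) :> R by lra.
  have h4 := ler_wpM2l (expR_ge0 (4^-1 : R)) h3; rewrite h2 in h4; lra.
have term (d : nat) : 2 ^- d * d.+1%:R ^+ p
  <= (q ^+ p * (4 / 3)) * (2 / 3) ^+ d.
  have h : d.+1%:R <= q * expR (d.+1%:R / q).
    rewrite mulrC -ler_pdivrMr//; by apply: le_trans (expR_ge1Dx _);
      rewrite lerDr.
  have {}h : d.+1%:R ^+ p <= q ^+ p * (4 / 3) ^+ d.+1.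
    apply: (@le_trans _ _ ((q * expR (d.+1%:R / q)) ^+ p)).
      by apply: lerXn2r => //; rewrite nnegrE// mulr_ge0 ?expR_ge0// ltW.
    rewrite exprMn ler_pM2l ?exprn_gt0//.
    apply: (@le_trans _ _ (expR 4^-1 ^+ d.+1)); last first.
      by rewrite lerXn2r// nnegrE ?expR_ge0.
    rewrite -!expRM_natr ler_expR /q natrM.
    have p1 : p%:R <= p.+1%:R :> R by rewrite ler_nat.
    have p2 : 0 < p.+1%:R :> R by rewrite ltr0n.
    rewrite mulrAC ler_pdivrMr ?mulr_gt0//.
    rewrite (_ : 4^-1 * d.+1%:R * (4 * p.+1%:R) = d.+1%:R * p.+1%:R);
      last by field.
    by rewrite ler_wpM2l.
  rewrite mulrC ler_pdivrMr ?exprn_gt0//; apply: le_trans h _.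
  rewrite -[leRHS]mulrA -exprMn (_ : 2 / 3 * 2 = 4 / 3); last by field.
  by rewrite exprS mulrA.
move=> D; apply: (@le_trans _ _ (\sum_(d < D) (q ^+ p * (4 / 3)) *
  (2 / 3) ^+ d)).
  exact: ler_sum.
rewrite -mulr_sumr mulrC; apply: ler_wpM2r;
  first by rewrite mulr_ge0// exprn_ge0// ltW.
have g : (1 - 2 / 3) * \sum_(d < D) (2 / 3) ^+ d = 1 - (2 / 3) ^+ D :> R.
  by rewrite -[LHS]opprK -mulNr opprB -subrX1 opprB.
have : 0 <= (2 / 3) ^+ D :> R by rewrite exprn_ge0.
move: g; move: (\sum_(d < D) _) => S; lra.
Qed.

(** * The expansion of the distribution of X_n *)

Lemma lambda_spec (R : realType) n : (0 < n)%N ->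
  (lambda R n)%:R <= log2 (n%:R : R) < (lambda R n).+1%:R.
Proof.
move=> n0; apply: truncn_itv.
by rewrite /log2 divr_ge0// ln_ge0// ler1n.
Qed.

Lemma pow2_log2B (R : realType) n l : (0 < n)%N ->
  2 `^ (log2 (n%:R : R) - l%:R) = n%:R / 2 ^+ l.
Proof.
move=> n0; have ln2 : ln (2 : R) != 0 by rewrite lt0r_neq0// ln_gt0// ltr1n.
rewrite powRB; last by rewrite pnatr_eq0 implybT.
rewrite powR_mulrn//; congr (_ / _).
by rewrite /powR pnatr_eq0 /= /log2 divfK// lnK// posrE ltr0n.
Qed.

Lemma mantissa_itv (R : realType) n : (0 < n)%N ->
  1 <= (n%:R : R) / 2 ^+ lambda R n < 2.
Proof.
move=> n0; have /andP[l1 l2] := lambda_spec R n0.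
rewrite -pow2_log2B// -[X in X <= _](@powRr0 _ 2) ler_powR ?ler1n ?subr_ge0//=.
rewrite -[X in _ < X](@powRr1 _ 2)// /powR pnatr_eq0/= ltr_expR.
by rewrite ltr_pM2r ?ln_gt0 ?ltr1n// ltrBlDl natr1.
Qed.

Section Mantissa.
Variables (R : realType) (n l : nat).
Let y : R := n%:R / 2 ^+ l.
Hypothesis y12 : 1 <= y < 2.
Let a := nones y.

Let y0 : 0 < y. Proof. by case/andP: y12 => *; lra. Qed.
Let p0 d : 0 < 2 ^+ d :> R. Proof. by rewrite exprn_gt0. Qed.
Let n0 : n%:R = y * 2 ^+ l. Proof. by rewrite divfK// lt0r_neq0. Qed.

Lemma sum_mantissa_digits : \sum_(d < l.+1 | bdigit y d) 2 ^- d = y.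
Proof. by rewrite digit_sumE// -n0 natrK. Qed.

Lemma ones_poly_mantissa : n%:R^-1 *: ones_poly R n =
  y^-1 *: \sum_(d < l.+1 | bdigit y d)
             2 ^- d *: ('X^(a d) * halfsum R ^+ (l - d)).
Proof.
have {1}-> : ones_poly R n = ones_poly R (leading y l).
  by rewrite /leading -n0 natrK.
rewrite ones_poly_leading// !scaler_sumr; apply: eq_bigr => d _.
rewrite n0 invfM -scalerA; congr (_ *: _).
have dl : (d <= l)%N by rewrite -ltnS.
have -> : ('X + 1) ^+ (l - d)
  = 2 ^+ (l - d) *: halfsum R ^+ (l - d) :> {poly R}.
  by rewrite -exprZn /halfsum scalerA divff ?pnatr_eq0// scale1r.
rewrite -scalerAr scalerA; congr (_ *: _).
rewrite -[in X in X^-1 * _](subnK dl) exprD invfM mulrAC mulVf ?mul1r//.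
Qed.

Definition mean_shift : R :=
  y^-1 * \sum_(d < l.+1 | bdigit y d) 2 ^- d * shift1 R (a d) d.

Definition curvature_shift : R :=
  y^-1 * \sum_(d < l.+1 | bdigit y d) 2 ^- d * shift2 R (a d) d.

(** The mean is the derivative at 1 of the generating polynomial, and
    X^a B^(l - d) has derivative a + (l - d)/2 there. *)
Lemma unif_mean_mantissa :
  unif_mean (fun m : 'I_n => (X m)%:R : R) - l%:R / 2 = mean_shift.
Proof.
rewrite unif_mean_onesE mulrC -hornerZ -derivZ ones_poly_mantissa.
rewrite derivZ hornerZ -[l%:R / 2](mulKf (lt0r_neq0 y0)) -mulrBr; congr (_ * _).
rewrite -[X in X * (l%:R / 2)]sum_mantissa_digits mulr_suml.
rewrite raddf_sum horner_sum -sumrB; apply: eq_bigr => d _.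
rewrite /= derivZ hornerZ -mulrBr; congr (_ * _).
have dl : (d <= l)%N by rewrite -ltnS.
rewrite derivM derivXn deriv_exp deriv_halfsum.
rewrite !(hornerD, hornerM, hornerMn, hornerXn, hornerC, horner_exp, halfsum1)
  !expr1n.
by rewrite /shift1 -(mulr_natr _ (l - d)) natrB//; field.
Qed.

(** The j-th digit 1 is preceded by a = j - 1 others; with this value of j the
    polynomial in j and d that defines F_2 is [shift2]. *)
Lemma F2_mantissa : (0 < n)%N -> l = lambda R n ->
  F2 (log2 (n%:R : R)) = curvature_shift.
Proof.
move=> np lE; have fl : Num.floor (log2 (n%:R : R)) = l.
  apply: floor_def; have := lambda_spec R np; rewrite -lE -natr1.
  by rewrite intrD.
rewrite /F2 fl /F2_01 powRN pow2_log2B// -/y; congr (_ * _).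
rewrite (lim_onepos_sum y12 _ (erefl : y = n%:R / 2 ^+ l)).
apply: eq_bigr => d bd; congr (_ * _).
by rewrite nonesS bd addn1 -natr1 -/(a d) /shift2; field.
Qed.

Lemma pnorm_remainder (K : R) :
  (forall D, \sum_(d < D) 2 ^- d * d.+1%:R ^+ 8 <= K) ->
  pnorm (n%:R^-1 *: ones_poly R n
    - (1 + mean_shift *: ('X - 1) + curvature_shift *: ('X - 1) ^+ 2)
      * halfsum R ^+ l)
  <= 208 * K * (Num.sqrt l.+1%:R) ^- 3.
Proof.
move=> KP; rewrite ones_poly_mantissa /mean_shift /curvature_shift.
set s := (Num.sqrt _) ^- 3.
have s0 : 0 <= s by rewrite invr_ge0 exprn_ge0// sqrtr_ge0.
set u := 'X - 1.
pose T (d : nat) := 'X^(a d) * halfsum R ^+ (l - d)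
  - (1 + shift1 R (a d) d *: u + shift2 R (a d) d *: u ^+ 2)
    * halfsum R ^+ l.
have -> : y^-1 *: (\sum_(d < l.+1 | bdigit y d)
    2 ^- d *: ('X^(a d) * halfsum R ^+ (l - d)))
  - (1 + (y^-1 * (\sum_(d < l.+1 | bdigit y d) 2 ^- d * shift1 R (a d) d)) *: u
     + (y^-1 * (\sum_(d < l.+1 | bdigit y d) 2 ^- d * shift2 R (a d) d))
       *: u ^+ 2)
    * halfsum R ^+ l
  = y^-1 *: \sum_(d < l.+1 | bdigit y d) 2 ^- d *: T d.
  have -> : 1 = (y^-1 * \sum_(d < l.+1 | bdigit y d) 2 ^- d) *: (1 : {poly R}).
    by rewrite sum_mantissa_digits mulVf ?scale1r// lt0r_neq0.
  rewrite -!scalerA -!scalerDr -scalerAl -scalerBr; congr (_ *: _).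
  rewrite !scaler_suml -!big_split /= mulr_suml -sumrB; apply: eq_bigr => d _.
  by rewrite /T [RHS]scalerBr -!scalerA -!scalerDr -scalerAl.
have yi0 : 0 <= y^-1 by rewrite invr_ge0 ltW.
rewrite pnormZ (ger0_norm yi0).
have y1 : y^-1 <= 1 by rewrite invf_le1//; case/andP: y12.
rewrite (le_trans (ler_piMl (pnorm_ge0 _) y1))//.
apply: le_trans (pnorm_sum _ _ _) _.
apply: (@le_trans _ _ (\sum_(d < l.+1) 208 * s * (2 ^- d * d.+1%:R ^+ 8)));
  last first.
  rewrite -mulr_sumr [leRHS]mulrAC; apply: ler_wpM2l (KP _).
  exact: mulr_ge0 (ler0n _ _) s0.
rewrite big_mkcond; apply: ler_sum => d _.
have [_|_] := ifP; last by rewrite !mulr_ge0// ?invr_ge0 ?exprn_ge0.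
rewrite pnormZ ger0_norm ?invr_ge0 ?exprn_ge0//.
rewrite mulrCA; apply: ler_wpM2l; first by rewrite invr_ge0 exprn_ge0.
rewrite mulrAC; apply: pnorm_second_order.
by rewrite nones_le//= -ltnS.
Qed.

Lemma norm_curvature_shift (K : R) :
  (forall D, \sum_(d < D) 2 ^- d * d.+1%:R ^+ 8 <= K) ->
  `|curvature_shift| <= 2 * K.
Proof.
move=> KP; have yi0 : 0 <= y^-1 by rewrite invr_ge0 ltW.
rewrite /curvature_shift normrM (ger0_norm yi0).
have y1 : y^-1 <= 1 by rewrite invf_le1//; case/andP: y12.
rewrite (le_trans (ler_piMl (normr_ge0 _) y1))//.
apply: le_trans (ler_norm_sum _ _ _) _.
apply: (@le_trans _ _ (\sum_(d < l.+1) 2 * (2 ^- d * d.+1%:R ^+ 8)));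
  last first.
  by rewrite -mulr_sumr ler_wpM2l.
rewrite big_mkcond; apply: ler_sum => d _.
have [_|_] := ifP; last by rewrite !mulr_ge0// ?invr_ge0 ?exprn_ge0.
rewrite normrM (ger0_norm (_ : 0 <= 2 ^- d)) ?invr_ge0 ?exprn_ge0//.
rewrite mulrCA; apply: ler_wpM2l; first by rewrite invr_ge0 exprn_ge0.
have := norm_shift2 R (nones_le y d); rewrite -/(a d) normrM ger0_norm// => h.
have d1 : 1 <= d.+1%:R :> R by rewrite ler1n.
have : d.+1%:R ^+ 2 <= d.+1%:R ^+ 8 :> R by rewrite ler_weXn2l.
have : 0 <= d.+1%:R ^+ 8 :> R by rewrite exprn_ge0.
lra.
Qed.

End Mantissa.

(** Minus the backward difference of the binomial distribution, in the form in
    which it enters the theorem. *)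
Lemma coef_diff_halfsum (R : numFieldType) l k : (k <= l)%N ->
  (('X - 1) * halfsum R ^+ l)`_k =
  - (2 ^- l * 'C(l, k)%:R * ((l%:R + 1 - 2 * k%:R) / (l%:R + 1 - k%:R))).
Proof.
move=> kl; rewrite mulrBl mul1r coefB coefXM !coef_halfsumX.
case: k kl => [|k] kl /=.
  by rewrite mulr0 !subr0 divff ?mulr1 ?add0r// natr1 pnatr_eq0.
have lk : l%:R - k%:R != 0 :> R
  by rewrite -natrB ?(ltnW kl)// pnatr_eq0 subn_eq0 -ltnNge.
have e : k.+1%:R * 'C(l, k.+1)%:R = (l%:R - k%:R) * 'C(l, k)%:R :> R.
  by rewrite -natrB ?(ltnW kl)// -!natrM mul_bin_left.
have -> : 'C(l, k)%:R = k.+1%:R * 'C(l, k.+1)%:R / (l%:R - k%:R) :> R.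
  by rewrite e mulrC mulKf.
rewrite -(natr1 k) (_ : l%:R + 1 - (k%:R + 1) = l%:R - k%:R); last by ring.
by field; rewrite lk expf_neq0// pnatr_eq0.
Qed.

(** The coefficients of degree l + 1 and l + 2, which the sum in the theorem
    leaves out, are exponentially small. *)
Lemma second_diff_norm_tail (R : realFieldType) l : (1 < l)%N ->
  second_diff_norm R l - \sum_(k < l.+1) `|(('X - 1) ^+ 2 * halfsum R ^+ l)`_k|
  <= 2 ^- l * l.+1%:R.
Proof.
move=> l1; rewrite /second_diff_norm (pnorm_wide (size_second_diff R l)).
rewrite 2!big_ord_recr /= -addrA addrAC subrr add0r.
have -> : (('X - 1) ^+ 2 * halfsum R ^+ l)
    = 'X * ('X * halfsum R ^+ l) - 2 *: ('X * halfsum R ^+ l) + halfsum R ^+ l.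
  by rewrite -mul_polyC polyC_natr; ring.
rewrite !coefD !coefN !coefZ !coefXM /= !coef_halfsumX.
rewrite (gtn_eqF (ltnW l1)) binn (@bin_small l l.+1)// (@bin_small l l.+2)//.
have -> : 'C(l, l.-1) = l by rewrite -{1}(prednK (ltnW l1)) binSn prednK// ltnW.
rewrite !mulr0 !mulr1 !subr0 !addr0.
have -> : 2 ^- l * l%:R - 2 * 2 ^- l = 2 ^- l * (l%:R - 2) :> R by ring.
have l2 : 2 <= l%:R :> R by rewrite ler_nat.
have i0 : 0 <= 2 ^- l :> R by rewrite invr_ge0 exprn_ge0.
rewrite !ger0_norm ?mulr_ge0 ?subr_ge0// -natr1.
nra.
Qed.

(** The theorem with an explicit range for n and with (l + 1)^(-3/2) as error
    term: the triangle inequality splits the sum into the contribution of the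
    remainder, the missing tail, and the second difference. *)
Lemma effective_expansion (R : realType) : exists2 C : R, 0 <= C &
  forall n, (8 <= n)%N ->
  let l := lambda R n in
  let b (k : nat) : R := 2 ^- l * ('C(l, k))%:R in
  `| \sum_(0 <= k < l.+1)
      `| unif_prob R [set m : 'I_n | X m == k] - b k
         + (unif_mean (fun m : 'I_n => (X m)%:R : R) - l%:R / 2) * b k
           * ((l%:R + 1 - 2 * k%:R) / (l%:R + 1 - k%:R)) |
    - 16 * `| F2 (log2 n%:R : R) | / (Num.sqrt (2 * pi * expR 1) * log2 n%:R) |
  <= C * (Num.sqrt l.+1%:R) ^- 3.
Proof.
have [K K0 KP] := geometric_moment_bounded R 8.
have [C C0 CP] := second_diff_norm_asymptotics R.
have KC0 := addr_ge0 K0 C0.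
have K208 : 0 <= 208 * K by exact: mulr_ge0 (ler0n _ _) K0.
exists (208 * K + 2 * K * (K + C)).
  by apply: addr_ge0 K208 (mulr_ge0 (mulr_ge0 _ K0) KC0).
move=> n n8 /=; have n0 : (0 < n)%N by apply: leq_trans n8.
have y12 := mantissa_itv R n0.
have /andP[x1 x2] := lambda_spec R n0.
rewrite (unif_mean_mantissa y12) (F2_mantissa y12 n0 erefl).
have rem := pnorm_remainder y12 KP; have vs := norm_curvature_shift y12 KP.
move: y12 x1 x2 rem vs; set l := lambda R n => y12.
set x := log2 _; set M := mean_shift _ _ _;
  set V := curvature_shift _ _ _ => x1 x2 rem vs.
have l3 : (3 <= l)%N.
  rewrite leqNgt; apply/negP => l2.
  have : (n%:R : R) < 2 * 2 ^+ l by case/andP: y12 => _;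
    rewrite ltr_pdivrMr// exprn_gt0.
  rewrite -exprS -natrX ltr_nat => nl.
  have := leq_trans nl (leq_pexp2l (isT : 0 < 2)%N l2).
  by rewrite ltnNge n8.
set s := (Num.sqrt _) ^- 3 in rem *.
have s0 : 0 < s by rewrite invr_gt0 exprn_gt0// sqrtr_gt0 ltr0n.
pose P := n%:R^-1 *: ones_poly R n - (1 + M *: ('X - 1)) * halfsum R ^+ l.
pose Q := V *: (('X - 1) ^+ 2 * halfsum R ^+ l).
have PQ : pnorm (P - Q) <= 208 * K * s.
  by apply: le_trans rem; rewrite /P /Q [in leRHS]mulrDl opprD addrA scalerAl.
set S := \sum_(0 <= k < _) _.
have SE : S = \sum_(k < l.+1) `|P`_k|.
  rewrite /S big_mkord; apply: eq_bigr => k _; congr `|_|.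
  have kl : (k <= l)%N by rewrite -ltnS.
  have -> : P`_k = (ones_poly R n)`_k / n%:R - (halfsum R ^+ l)`_k
      - M * (('X - 1) * halfsum R ^+ l)`_k.
    rewrite /P mulrDl mul1r -scalerAl opprD addrA !coefB !coefZ.
    by rewrite [n%:R^-1 * _]mulrC.
  rewrite unif_prob_onesE coef_halfsumX coef_diff_halfsum// mulrN opprK.
  by rewrite !mulrA.
have h1 := pnorm_triangle P Q l.+1; rewrite -SE in h1.
have QE : \sum_(k < l.+1) `|Q`_k|
    = `|V| * \sum_(k < l.+1) `|(('X - 1) ^+ 2 * halfsum R ^+ l)`_k|.
  by rewrite mulr_sumr; apply: eq_bigr => k _; rewrite /Q coefZ normrM.
set W := \sum_(k < l.+1) `|(('X - 1) ^+ 2 * _)`_k| in QE.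
have W1 : W <= second_diff_norm R l by exact: le_sum_pnorm.
have W2 : second_diff_norm R l - W <= K * s.
  apply: le_trans (second_diff_norm_tail R (ltnW l3)) _.
  rewrite ler_pdivlMr ?exprn_gt0 ?sqrtr_gt0 ?ltr0n//.
  apply: le_trans (KP l.+1); rewrite big_ord_recr /=.
  apply: (@le_trans _ _ (2 ^- l * l.+1%:R ^+ 8)); last first.
    by rewrite lerDr sumr_ge0// => d _; rewrite mulr_ge0// ?invr_ge0 ?exprn_ge0.
  rewrite -mulrA ler_pM2l ?invr_gt0 ?exprn_gt0//.
  have l1 : 1 <= l.+1%:R :> R by rewrite ler1n.
  apply: (@le_trans _ _ (l.+1%:R * l.+1%:R ^+ 3)); last first.
    by rewrite -exprS ler_weXn2l.
  rewrite ler_pM2l ?ltr0n// lerXn2r// ?nnegrE ?sqrtr_ge0//.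
  rewrite -[leRHS]ger0_norm// -sqrtr_sqr ler_wsqrtr//.
  by rewrite expr2 ler_peMl.
have h2 : `|second_diff_norm R l - 16 / (Num.sqrt (2 * pi * expR 1) * x)|
  <= C * s.
  by apply: CP => //; rewrite x1 ltW.
set A := 16 / _ in h2.
have -> : 16 * `|V| / (Num.sqrt (2 * pi * expR 1) * x) = `|V| * A.
  by rewrite mulrAC mulrC.
have h3 : `|W - A| <= (K + C) * s.
  have -> : W - A = - (second_diff_norm R l - W) + (second_diff_norm R l - A)
    by ring.
  rewrite mulrDl; apply: le_trans (ler_normD _ _) (lerD _ h2).
  by rewrite normrN ger0_norm// subr_ge0.
have h4 : `|S - `|V| * W| <= 208 * K * s by rewrite -QE; exact: le_trans h1 PQ.
have -> : S - `|V| * A = (S - `|V| * W) + `|V| * (W - A) by ring.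
apply: le_trans (ler_normD _ _) _; rewrite mulrDl; apply: lerD => //.
rewrite normrM normr_id -mulrA; apply: ler_pM => //.
Qed.

Theorem corollary2p3 (R : realType) :
  (fun n : nat =>
    let l := lambda R n in
    let b (k : nat) : R := 2 ^- l * ('C(l, k))%:R in
    \sum_(0 <= k < l.+1)
      `| unif_prob R [set m : 'I_n | X m == k] - b k
         + (unif_mean (fun m : 'I_n => (X m)%:R : R) - l%:R / 2) * b k
           * ((l%:R + 1 - 2 * k%:R) / (l%:R + 1 - k%:R)) |)
  = (fun n : nat =>
      16 * `| F2 (log2 n%:R : R) |
      / (Num.sqrt (2 * pi * expR 1) * log2 n%:R))
  +O_\oo (fun n : nat => (ln n%:R : R) `^ (- (3 / 2))).
Proof.
have [C C0 CP] := effective_expansion R.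
apply/eqaddOP; near=> k; near=> n.
have n8 : (8 <= n)%N by near: n; exists 8%N.
have kC : C <= k by near: k; apply: nbhs_pinfty_ge; exact: num_real.
have := CP n n8; rewrite /= => h; apply: le_trans h _.
have n0 : (0 < n)%N by apply: leq_trans n8.
have /andP[_ x2] := lambda_spec R n0.
have n1 : 1 < n%:R :> R by rewrite ltr1n; apply: leq_trans n8.
have L0 : 0 < ln (n%:R : R) by rewrite ln_gt0.
rewrite ger0_norm ?powR_ge0//.
rewrite powRN (_ : 3 / 2 = 2^-1 * 3%:R); last by field.
rewrite powRrM powR12_sqrt ?(ltW L0)// powR_mulrn ?sqrtr_ge0//.
apply: ler_pM => //.
rewrite lef_pV2 ?posrE ?exprn_gt0 ?sqrtr_gt0 ?ltr0n//.
apply: lerXn2r; rewrite ?nnegrE ?sqrtr_ge0//; apply: ler_wsqrtr.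
apply: le_trans (ltW x2); rewrite /log2 ler_pdivlMr ?ln_gt0 ?ltr1n//.
rewrite ler_piMr ?(ltW L0)//.
by have := @le_ln1Dx R 1; rewrite (_ : 1 + 1 = 2)//; apply; lra.
Unshelve. all: by end_near.
Qed.
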